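(* Let $(\mathfrak{g},\rho,V,\mathcal{V},B_0)$ be a standard pentad over a field $\mathfrak{k}$, let $L(\mathfrak{g},\rho,V,\mathcal{V},B_0)=\bigoplus_{n\in\mathbb{Z}}V_n$ be the graded Lie algebra associated with it, and let $\pi:\mathfrak{g}\otimes U\to U$ be a representation of $\mathfrak{g}$ on a vector space $U$ over $\mathfrak{k}$. Then the vector space $\tilde U^-=\bigoplus_{m\in\mathbb{Z}}U^-_m=\bigoplus_{m\le0}U^-_m$ has the structure of a negatively graded $L(\mathfrak{g},\rho,V,\mathcal{V},B_0)$-module whose representation is $\tilde\pi^-$.
   Context: All objects are over a field $\mathfrak{k}$ and may be infinite-dimensional. A representation of a Lie algebra $\mathfrak{l}$ on $W$ is written as a linear map $\mathfrak{l}\otimes W\to W$. A module $(\varpi,W)$, $W=\bigoplus_{m\le0}W_m$, of a graded Lie algebra $\bigoplus_n\mathfrak{l}_n$ is negatively graded if $\varpi(\mathfrak{l}_n\otimes W_m)\subset W_{n+m}$ for all $n,m$ (with $W_k=\{0\}$ for $k>0$). Standard pentad $(\mathfrak{g},\rho,V,\mathcal{V},B_0)$: $\mathfrak{g}$ is a non-zero Lie algebra with a non-degenerate invariant bilinear form $B_0$ ($B_0([a,b],c)=B_0(a,[b,c])$; not assumed symmetric), $\rho:\mathfrak{g}\otimes V\to V$ is a representation, $\mathcal{V}$ is a $\mathfrak{g}$-submodule of $\mathrm{Hom}(V,\mathfrak{k})$ with canonical representation $\varrho$ (so $\langle\rho(a\otimes v),\phi\rangle=-\langle v,\varrho(a\otimes\phi)\rangle$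 for the canonical pairing $\langle\cdot,\cdot\rangle$), such that (i) $\langle\cdot,\cdot\rangle$ restricted to $V\times\mathcal{V}$ is non-degenerate, (ii) there is a (necessarily unique) linear map $\Phi_\rho:V\otimes\mathcal{V}\to\mathfrak{g}$ with $B_0(a,\Phi_\rho(v\otimes\phi))=\langle\rho(a\otimes v),\phi\rangle$ for all $a,v,\phi$. Put $\Psi_\rho(\phi\otimes v):=-\Phi_\rho(v\otimes\phi)$. Associated graded Lie algebra $L(\mathfrak{g},\rho,V,\mathcal{V},B_0)=\bigoplus_{n}V_n$: $V_0:=\mathfrak{g}$, $V_1:=V$, $V_{-1}:=\mathcal{V}$, with canonical representations $\rho_0$ (adjoint), $\rho_1=\rho$, $\rho_{-1}=\varrho$. For $x\in V_1$, $y\in V_{-1}$ write $x(y):=\Phi_\rho(x\otimes y)$, $y(x):=\Psi_\rho(y\otimes x)$. Let $p_0(x\otimes a):=-\rho_1(a\otimes x)$, $q_0(y\otimes a):=-\rho_{-1}(a\otimes y)$ for $a\in V_0$. Define $p_1:V_1\otimes V_1\to\mathrm{Hom}(V_{-1},V_1)$ by $p_1(v\otimes u)(\eta)=\rho_1(v(\eta)\otimes u)-\rho_1(u(\eta)\otimes v)$ and $q_{-1}:V_{-1}\otimes V_{-1}\to\mathrm{Hom}(V_1,V_{-1})$ by $q_{-1}(\phi\otimes\psi)(\xi)=\rho_{-1}(\phi(\xi)\otimes\psi)-\rho_{-1}(\psi(\xi)\otimes\phi)$. For $i\ge2$, inductively, $V_i:=\mathrm{Im}\,p_{i-1}\subset\mathrm{Hom}(V_{-1},V_{i-1})$,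 $V_{-i}:=\mathrm{Im}\,q_{-i+1}\subset\mathrm{Hom}(V_1,V_{-i+1})$ with the canonical $\mathfrak{g}$-module structures $\rho_{i},\rho_{-i}$, and $p_i:V_1\otimes V_i\to\mathrm{Hom}(V_{-1},V_i)$, $p_i(v\otimes u)(\eta)=\rho_i(v(\eta)\otimes u)+p_{i-1}(v\otimes u(\eta))$; $q_{-i}:V_{-1}\otimes V_{-i}\to\mathrm{Hom}(V_1,V_{-i})$, $q_{-i}(\phi\otimes\psi)(\xi)=\rho_{-i}(\phi(\xi)\otimes\psi)+q_{-i+1}(\phi\otimes\psi(\xi))$. The Lie bracket satisfies, for $a\in V_0$, $x\in V_1$, $y\in V_{-1}$, $z_n\in V_n$: $[a,z_n]=\rho_n(a\otimes z_n)$; $[x,z_n]=p_n(x\otimes z_n)$ if $n\ge0$, $=-z_n(x)$ if $n\le-1$; $[y,z_n]=-z_n(y)$ if $n\ge1$, $=q_n(y\otimes z_n)$ if $n\le0$; and it is extended inductively ($i\ge1$) by $[p_i(x\otimes z_i),w]=[x,[z_i,w]]-[z_i,[x,w]]$, $[q_{-i}(y\otimes\omega_{-i}),w]=[y,[\omega_{-i},w]]-[\omega_{-i},[y,w]]$. It is a theorem that this is a well-defined graded Lie algebra ($[V_n,V_m]\subset V_{n+m}$, generated by $V_{-1}\oplus V_0\oplus V_1$). Spaces $U_m^-$: $U_0^-:=U$, $\pi_0^-:=\pi$, $r_0^-:V_{-1}\otimes U_0^-\to\mathrm{Hom}(V_1,U_0^-)$, $r_0^-(y\otimes u)(\xi)=\pi_0^-([\xi,y]\otimes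 u)$. For $j\ge1$, inductively, $U_{-j}^-:=\mathrm{Im}\,r_{-j+1}^-\subset\mathrm{Hom}(V_1,U_{-j+1}^-)$, a $\mathfrak{g}$-submodule with representation $\pi_{-j}^-$, and $r_{-j}^-:V_{-1}\otimes U_{-j}^-\to\mathrm{Hom}(V_1,U_{-j}^-)$, $r_{-j}^-(y\otimes u)(\xi)=\pi_{-j}^-([\xi,y]\otimes u)+r_{-j+1}^-(y\otimes u(\xi))$ (these are $\mathfrak{g}$-module homomorphisms). $U_j^-:=\{0\}$ for $j\ge1$. Map $\tilde\pi^-:L(\mathfrak{g},\rho,V,\mathcal{V},B_0)\otimes\tilde U^-\to\tilde U^-$: it is given by $\tilde\pi^-(z_n\otimes u_m)=\pi^-_{n,m}(z_n\otimes u_m)$ for $z_n\in V_n$, $u_m\in U_m^-$, where $\pi^-_{n,m}:V_n\otimes U_m^-\to U_{n+m}^-$ are the linear maps with $\pi^-_{0,m}=\pi_m^-$; $\pi^-_{1,m}(x\otimes u)=0$ for $m\ge0$ and $u(x)$ for $m\le-1$; $\pi^-_{-1,m}(y\otimes u)=0$ for $m\ge1$ and $r_m^-(y\otimes u)$ for $m\le0$; and inductively for $i\ge1$, $\pi^-_{i+1,m}(p_i(x\otimes z_i)\otimes u)=\pi^-_{1,i+m}(x\otimes\pi^-_{i,m}(z_i\otimes u))-\pi^-_{i,m+1}(z_i\otimes\pi^-_{1,m}(x\otimes u))$ and $\pi^-_{-i-1,m}(q_{-i}(y\otimes\omega_{-i})\otimes u)=\pi^-_{-1,-i+m}(y\otimes\pi^-_{-i,m}(\omega_{-i}\otimes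 u))-\pi^-_{-i,m-1}(\omega_{-i}\otimes\pi^-_{-1,m}(y\otimes u))$ (these formulas give well-defined maps). $(\tilde\pi^-,\tilde U^-)$ is called the negative extension of $U$ with respect to the pentad. *)

(* Defs.v *)
From HB Require Import structures.
From mathcomp Require Import all_boot all_algebra.
From mathcomp Require Import boolp classical_sets functions.

Set Implicit Arguments.
Unset Strict Implicit.
Unset Printing Implicit Defensive.

Import GRing.Theory.
Local Open Scope ring_scope.

Inductive zexp := ZVar of nat | ZZero | ZAdd of zexp & zexp | ZOpp of zexp.

Section ZEval.
Variables (A : zmodType) (v : seq A).
Fixpoint zeval e : A :=
  match e with
  | ZVar i => nth 0 v i | ZZero => 0
  | ZAdd e e' => zeval e + zeval e' | ZOpp e => - zeval e
  end.
Fixpoint zlist (b : bool) e : seq nat :=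
  match e with
  | ZVar i => if b then [:: i] else [::] | ZZero => [::]
  | ZAdd e e' => zlist b e ++ zlist b e' | ZOpp e => zlist (~~ b) e
  end.
Lemma zlistP e : zeval e =
  \sum_(i <- zlist true e) nth 0 v i - \sum_(i <- zlist false e) nth 0 v i.
Proof.
elim: e => [i||e IH e' IH'|e IH] /=; rewrite ?big_nil ?big_seq1 ?subr0 //.
  by rewrite IH IH' !big_cat opprD addrACA.
by rewrite IH opprB.
Qed.
Lemma zeq e e' :
  perm_eq (zlist true e ++ zlist false e') (zlist true e' ++ zlist false e) ->
  zeval e = zeval e'.
Proof.
move=> p; rewrite !zlistP; apply/eqP.
rewrite subr_eq addrAC eq_sym subr_eq -!big_cat eq_sym; apply/eqP.
by rewrite (perm_big _ p).
Qed.
End ZEval.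

Ltac zsame x y :=
  lazymatch x with
  | y => constr:(true)
  | _ => match constr:(O) with
         | _ => let _ := constr:(erefl x : x = y) in constr:(true)
         | _ => constr:(false)
         end
  end.
Ltac zfind x v :=
  lazymatch v with
  | nil => constr:(O)
  | cons ?y ?w => let b := zsame x y in
      lazymatch b with
      | true => constr:(O)
      | _ => let n := zfind x w in constr:(S n)
      end
  end.
Ltac zmember x v :=
  lazymatch v with
  | nil => constr:(false)
  | cons ?y ?w => let b := zsame x y in
      lazymatch b with true => constr:(true) | _ => zmember x w end
  end.
Ltac zvars v t :=
  lazymatch t with
  | GRing.add ?x ?y => let w := zvars v x in zvars w y
  | GRing.opp ?x => zvars v x
  | GRing.zero => v
  | ?x => let b := zmember x v in
          lazymatch b with true => v | false => constr:(cons x v) end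
  end.
Ltac zreify v t :=
  lazymatch t with
  | GRing.add ?x ?y =>
      let a := zreify v x in let b := zreify v y in constr:(ZAdd a b)
  | GRing.opp ?x => let a := zreify v x in constr:(ZOpp a)
  | GRing.zero => constr:(ZZero)
  | ?x => let n := zfind x v in constr:(ZVar n)
  end.
Ltac zmod :=
  lazymatch goal with
  | |- @eq ?A ?l ?r =>
      let v := zvars (@nil A) l in let v := zvars v r in
      let a := zreify v l in let b := zreify v r in
      apply: (@zeq _ v a b); reflexivity
  end.

(* A linear map U (x) V -> W is given as a bilinear map U -> V -> W. *)
Definition bilin (K : fieldType) (U V W : lmodType K) (f : U -> V -> W) : Prop :=
  (forall v, linear (f^~ v)) /\ (forall u, linear (f u)).

Section Bilin.
Variables (K : fieldType) (U V W : lmodType K) (f : U -> V -> W).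
Hypothesis hf : bilin f.

Lemma bilinPl a u u' v : f (a *: u + u') v = a *: f u v + f u' v.
Proof. exact: hf.1. Qed.
Lemma bilinPr a u v v' : f u (a *: v + v') = a *: f u v + f u v'.
Proof. exact: hf.2. Qed.
Lemma bilinDl u u' v : f (u + u') v = f u v + f u' v.
Proof. by rewrite -[u in LHS]scale1r bilinPl scale1r. Qed.
Lemma bilinDr u v v' : f u (v + v') = f u v + f u v'.
Proof. by rewrite -[v in LHS]scale1r bilinPr scale1r. Qed.
Lemma bilin0l v : f 0 v = 0.
Proof. by apply: (@addrI _ (f 0 v)); rewrite -bilinDl !addr0. Qed.
Lemma bilin0r u : f u 0 = 0.
Proof. by apply: (@addrI _ (f u 0)); rewrite -bilinDr !addr0. Qed.
Lemma bilinZl a u v : f (a *: u) v = a *: f u v.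
Proof. by rewrite -[a *: u]addr0 bilinPl bilin0l addr0. Qed.
Lemma bilinZr a u v : f u (a *: v) = a *: f u v.
Proof. by rewrite -[a *: v]addr0 bilinPr bilin0r addr0. Qed.
Lemma bilinNl u v : f (- u) v = - f u v.
Proof. by rewrite -scaleN1r bilinZl scaleN1r. Qed.
Lemma bilinNr u v : f u (- v) = - f u v.
Proof. by rewrite -scaleN1r bilinZr scaleN1r. Qed.
Lemma bilinBl u u' v : f (u - u') v = f u v - f u' v.
Proof. by rewrite bilinDl bilinNl. Qed.
Lemma bilinBr u v v' : f u (v - v') = f u v - f u v'.
Proof. by rewrite bilinDr bilinNr. Qed.
End Bilin.

Section Linear.
Variables (K : fieldType) (V W : lmodType K) (f : V -> W).
Hypothesis hf : linear f.
Lemma linD v v' : f (v + v') = f v + f v'.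
Proof. by rewrite -[v in LHS]scale1r hf scale1r. Qed.
Lemma lin0 : f 0 = 0.
Proof. by apply: (@addrI _ (f 0)); rewrite -linD !addr0. Qed.
Lemma linZ a v : f (a *: v) = a *: f v.
Proof. by rewrite -[a *: v]addr0 hf lin0 addr0. Qed.
Lemma linN v : f (- v) = - f v.
Proof. by rewrite -scaleN1r linZ scaleN1r. Qed.
Lemma linB v v' : f (v - v') = f v - f v'.
Proof. by rewrite linD linN. Qed.
Lemma lin_sum (I : Type) (s : seq I) (F : I -> V) :
  f (\sum_(i <- s) F i) = \sum_(i <- s) f (F i).
Proof. by elim: s => [|i s IH]; rewrite ?big_nil ?lin0 // !big_cons linD IH. Qed.
End Linear.

Definition is_lie_bracket (K : fieldType) (L : lmodType K) (br : L -> L -> L) :=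
  [/\ bilin br,
      forall a, br a a = 0 &
      forall a b c, br a (br b c) + br b (br c a) + br c (br a b) = 0].

Record lieAlgebra (K : fieldType) := LieAlgebra {
  lie_car :> lmodType K;
  lie_br : lie_car -> lie_car -> lie_car;
  lie_brP : is_lie_bracket lie_br }.

Notation "[< a , b >]" := (lie_br a b) (at level 0, a, b at level 99).

Section LieTheory.
Variables (K : fieldType) (g : lieAlgebra K).
Implicit Types a b c : g.

Lemma lie_bilin : bilin (@lie_br K g).
Proof. by case: (lie_brP g). Qed.
Lemma lie_alt a : [< a, a >] = 0.
Proof. by case: (lie_brP g). Qed.
Lemma lie_anti a b : [< a, b >] = - [< b, a >].
Proof.
apply/eqP; rewrite -addr_eq0; apply/eqP; have := lie_alt (a + b).
by rewrite !(bilinDl lie_bilin, bilinDr lie_bilin) !lie_alt add0r addr0 addrC.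
Qed.
Lemma lie_jacobi a b c :
  [< [< a, b >], c >] = [< a, [< b, c >] >] - [< b, [< a, c >] >].
Proof.
case: (lie_brP g) => _ _ /(_ a b c) J.
rewrite (lie_anti _ c) (lie_anti a c) (bilinNr lie_bilin b) opprK.
by apply/eqP; rewrite eq_sym -addr_eq0 J.
Qed.
End LieTheory.

Definition is_rep (K : fieldType) (g : lieAlgebra K) (W : lmodType K)
    (act : g -> W -> W) : Prop :=
  bilin act /\
  forall a b w, act [< a, b >] w = act a (act b w) - act b (act a w).

Record lieModule (K : fieldType) (g : lieAlgebra K) := LieModule {
  mod_car :> lmodType K;
  mod_act : g -> mod_car -> mod_car;
  mod_actP : is_rep mod_act }.

Notation "a ∙ w" := (mod_act a w) (at level 40, left associativity).

Section ModTheory.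
Variables (K : fieldType) (g : lieAlgebra K) (W : lieModule g).
Lemma act_bilin : bilin (@mod_act K g W).
Proof. by case: (mod_actP W). Qed.
Lemma act_rep (a b : g) (w : W) : [< a, b >] ∙ w = a ∙ (b ∙ w) - b ∙ (a ∙ w).
Proof. by case: (mod_actP W). Qed.
End ModTheory.

Lemma adjoint_rep (K : fieldType) (g : lieAlgebra K) : is_rep (@lie_br K g).
Proof. by split; [exact: lie_bilin | exact: lie_jacobi]. Qed.
Definition adjoint (K : fieldType) (g : lieAlgebra K) : lieModule g :=
  LieModule (adjoint_rep g).

Record subspace (K : fieldType) (W : lmodType K) := Subspace {
  subspace_pred :> {pred W};
  subspaceP : submod_closed subspace_pred }.

Section SubspaceType.
Variables (K : fieldType) (W : lmodType K) (S : subspace W).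

Definition subspace_mem : {pred W} := subspace_pred S.
HB.instance Definition _ :=
  GRing.isSubmodClosed.Build K W subspace_mem (subspaceP S).

Record sub_sort := SubSort { sub_val : W; sub_valP : sub_val \in subspace_mem }.
HB.instance Definition _ := [isSub for sub_val].
HB.instance Definition _ := [Choice of sub_sort by <:].
HB.instance Definition _ := [SubChoice_isSubLmodule of sub_sort by <:].

Lemma sub_val_inj : injective sub_val.
Proof. exact: val_inj. Qed.
Lemma sub_val_lin : linear sub_val.
Proof. by move=> a u v; rewrite -[sub_val]/(val : sub_sort -> W) linearP. Qed.
End SubspaceType.

Section Span.
Variables (K : fieldType) (W : lmodType K) (X : set W).

Definition span_pred : {pred W} := fun w =>
  `[< exists2 s : seq (K * W), (forall c, c \in s -> X c.2) &
        w = \sum_(c <- s) c.1 *: c.2 >].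

Lemma span_closed : submod_closed span_pred.
Proof.
split; first by apply/asboolP; exists [::]; rewrite ?big_nil.
move=> a u v /asboolP[s Xs ->] /asboolP[t Xt ->].
apply/asboolP; exists ([seq (a * c.1, c.2) | c <- s] ++ t).
  by move=> c; rewrite mem_cat => /orP[/mapP[d /Xs Xd ->]|/Xt].
rewrite big_cat big_map scaler_sumr /=; congr (_ + _).
by apply: eq_bigr => c _; rewrite scalerA.
Qed.

Definition span : subspace W := Subspace span_closed.

Lemma span_ind (P : W -> Prop) :
  P 0 -> (forall a u v, X u -> P v -> P (a *: u + v)) ->
  forall w, w \in subspace_mem span -> P w.
Proof.
move=> P0 PD w /asboolP[s Xs ->]; elim: s Xs => [|c s IH] Xs.
  by rewrite big_nil.
rewrite big_cons; apply: PD; first by apply: Xs; rewrite inE eqxx.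
by apply: IH => d ds; apply: Xs; rewrite inE ds orbT.
Qed.
Lemma span_gen w : X w -> w \in subspace_mem span.
Proof.
move=> Xw; apply/asboolP; exists [:: (1, w)]; last by rewrite big_seq1 scale1r.
by move=> c; rewrite inE => /eqP ->.
Qed.
End Span.

Lemma fct_linE (K : fieldType) (T : Type) (W : lmodType K) (a : K) (f h : T -> W) x :
  (a *: f + h) x = a *: f x + h x.
Proof. by []. Qed.

Lemma lin_shuffle (K : fieldType) (W : lmodType K) (a b : K) (x y z t : W) :
  a *: (b *: x + y) + (b *: z + t) = b *: (a *: x + z) + (a *: y + t).
Proof. by rewrite !scalerDr !scalerA [b * a]mulrC addrACA. Qed.

(* The tower of modules: given D, G, pair : G (x) D -> g and a first step
   lr_0 : G (x) X_0 -> Hom(D, X_0), put X_{n+1} := Im lr_n (the linear span of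
   the lr_n (y (x) u) in the space of maps D -> X_n) and
   lr_{n+1} (y (x) f) (d) := pair(y (x) d) . f + lr_n (y (x) f(d)). *)

Section Tower.
Variables (K : fieldType) (g : lieAlgebra K) (G D : lieModule g).

Record level := Level {
  lv :> lieModule g;
  lr : G -> lv -> D -> lv;
  lr_bilin : bilin (lr : G -> lv -> (D -> lv));
  lr_lin : forall y u, linear (lr y u);
  lr_equiv : forall a y u d,
    a ∙ lr y u d - lr y u (a ∙ d) = lr (a ∙ y) u d + lr y (a ∙ u) d }.

Variable pair : G -> D -> g.
Hypothesis pair_bilin : bilin pair.
Hypothesis pair_equiv : forall a y d,
  [< a, pair y d >] = pair (a ∙ y) d + pair y (a ∙ d).

Section Next.
Variable L : level.

Definition im_step : subspace (D -> L) :=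
  span (fun f : D -> L => exists y u, f = lr y u).
Definition next_car : lmodType K := sub_sort im_step.

Lemma im_step_lin (f : D -> L) : f \in subspace_mem im_step -> linear f.
Proof.
move: f; apply: span_ind => [a u v|b f h [y [u ->]] hlin a d d'].
  by rewrite scaler0 addr0.
by rewrite !fct_linE lr_lin hlin -lin_shuffle.
Qed.

Lemma im_step_act a (f : D -> L) : f \in subspace_mem im_step ->
  (fun d => a ∙ f d - f (a ∙ d)) \in subspace_mem im_step.
Proof.
move: f; apply: span_ind => [|b f h [y [u ->]] hm].
  rewrite (_ : (fun _ => _) = 0); first exact: (subspaceP im_step).1.
  by apply/funext => d; rewrite /= (bilin0r (@act_bilin _ _ L)) subrr.
have key : (fun d => a ∙ lr y u d - lr y u (a ∙ d)) \in subspace_mem im_step.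
  rewrite (_ : (fun _ => _) = lr (a ∙ y) u + lr y (a ∙ u)).
    by apply: rpredD; apply: span_gen; eexists; eexists.
  by apply/funext => d; rewrite lr_equiv.
rewrite (_ : (fun _ => _) =
    b *: (fun d => a ∙ lr y u d - lr y u (a ∙ d))
    + (fun d => a ∙ h d - h (a ∙ d))).
  by apply: rpredD => //; apply: rpredZ.
apply/funext => d; rewrite !fct_linE (bilinPr (@act_bilin _ _ L)).
by rewrite scalerBr opprD addrACA.
Qed.

Definition next_val (f : next_car) : D -> L := sub_val f.

Lemma next_val_linl (d : D) : linear (next_val^~ d).
Proof. by move=> a u v; rewrite /next_val sub_val_lin. Qed.
Lemma next_val_lin (f : next_car) : linear (next_val f).
Proof. exact: (im_step_lin (sub_valP f)). Qed.
Lemma next_val_inj (f h : next_car) : next_val f =1 next_val h -> f = h.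
Proof. by move=> fh; apply: sub_val_inj; apply/funext. Qed.

Definition next_act (a : g) (f : next_car) : next_car :=
  SubSort (im_step_act a (sub_valP f)).

Lemma next_actE a f d : next_val (next_act a f) d = a ∙ next_val f d - next_val f (a ∙ d).
Proof. by []. Qed.

Lemma next_act_rep : is_rep next_act.
Proof.
have aL := @act_bilin _ _ L; have aD := @act_bilin _ _ D.
split; [split|] => [f a b c|a b f h|a b f]; apply: next_val_inj => d.
- rewrite next_val_linl !next_actE (bilinPl aL) (bilinPl aD) next_val_lin.
  by rewrite scalerBr opprD addrACA.
- rewrite next_val_linl !next_actE !next_val_linl (bilinPr aL).
  by rewrite scalerBr opprD addrACA.
rewrite (linB (next_val_linl d)) !next_actE !act_rep.
rewrite (linB (next_val_lin f)) !(bilinBr aL) !opprB.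
zmod.
Qed.
Definition next_mod : lieModule g := LieModule next_act_rep.

Definition next_in (y : G) (u : L) : next_mod :=
  SubSort (span_gen (ex_intro _ y (ex_intro _ u (erefl (lr y u))))).

Definition next_lr (y : G) (f : next_mod) (d : D) : next_mod :=
  pair y d ∙ f + next_in y (next_val f d).

Lemma next_inE y u d : next_val (next_in y u) d = lr y u d.
Proof. by []. Qed.
Lemma next_in_bilin : bilin next_in.
Proof.
split=> [u|y] a v w; apply: next_val_inj => d; rewrite next_val_linl !next_inE.
  by rewrite (bilinPl (lr_bilin L)).
by rewrite (bilinPr (lr_bilin L)).
Qed.
Lemma next_in_equiv a y u : a ∙ next_in y u = next_in (a ∙ y) u + next_in y (a ∙ u).
Proof.
apply: next_val_inj => d; rewrite (linD (next_val_linl d)) next_actE !next_inE.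
exact: lr_equiv.
Qed.

Lemma next_lr_bilin : bilin (next_lr : G -> next_mod -> (D -> next_mod)).
Proof.
have aN := @act_bilin _ _ next_mod.
split=> [u|y] a v w; apply/funext => d; rewrite fct_linE /next_lr.
  by rewrite (bilinPl pair_bilin) (bilinPl aN) (bilinPl next_in_bilin) scalerDr addrACA.
by rewrite (bilinPr aN) next_val_linl (bilinPr next_in_bilin) scalerDr addrACA.
Qed.
Lemma next_lr_lin y u : linear (next_lr y u).
Proof.
have aN := @act_bilin _ _ next_mod.
move=> a d e; rewrite /next_lr (bilinPr pair_bilin) (bilinPl aN) next_val_lin.
by rewrite (bilinPr next_in_bilin) scalerDr addrACA.
Qed.
Lemma next_lr_equiv a y u d :
  a ∙ next_lr y u d - next_lr y u (a ∙ d) = next_lr (a ∙ y) u d + next_lr y (a ∙ u) d.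
Proof.
have aN := @act_bilin _ _ next_mod.
rewrite /next_lr (bilinDr aN) next_in_equiv next_actE (bilinBr next_in_bilin).
have := act_rep a (pair y d) u; rewrite pair_equiv (bilinDl aN) => /eqP.
rewrite eq_sym subr_eq => /eqP ->.
zmod.
Qed.

Definition next : level :=
  @Level next_mod next_lr next_lr_bilin next_lr_lin next_lr_equiv.
End Next.

Definition tower (L0 : level) (n : nat) : level := iter n next L0.

(* the canonical map G (x) X_n -> X_{n+1} given by lr_n *)
Definition tstep (L0 : level) n (y : G) (u : tower L0 n) : tower L0 n.+1 := next_in y u.
(* X_{n+1} as a space of maps D -> X_n *)
Definition teval (L0 : level) n (f : tower L0 n.+1) (d : D) : tower L0 n := next_val f d.

Variable L0 : level.

Lemma tstep_bilin n : bilin (@tstep L0 n).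
Proof. exact: next_in_bilin. Qed.
Lemma teval_bilin n : bilin (@teval L0 n).
Proof. by split=> [d|f]; [exact: next_val_linl | exact: next_val_lin]. Qed.
Lemma teval_inj n (f h : tower L0 n.+1) : teval f =1 teval h -> f = h.
Proof. exact: next_val_inj. Qed.
Lemma teval_act n a (f : tower L0 n.+1) d :
  teval (a ∙ f) d = a ∙ teval f d - teval f (a ∙ d).
Proof. exact: next_actE. Qed.
Lemma tstep_act n a y (u : tower L0 n) :
  a ∙ tstep y u = tstep (a ∙ y) u + tstep y (a ∙ u).
Proof. exact: next_in_equiv. Qed.
Lemma teval0 y (u : tower L0 0) d : teval (tstep y u) d = lr y u d.
Proof. by []. Qed.
Lemma tevalS n y (u : tower L0 n.+1) d :
  teval (tstep y u) d = pair y d ∙ u + tstep y (teval u d).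
Proof. by []. Qed.
Lemma tower_ind n (P : tower L0 n.+1 -> Prop) :
  P 0 -> (forall a y u f, P f -> P (a *: tstep y u + f)) -> forall f, P f.
Proof.
move=> P0 PD f; have := sub_valP f.
set Q := fun w : D -> tower L0 n => forall f : tower L0 n.+1, next_val f = w -> P f.
suff: forall w, w \in subspace_mem (im_step (tower L0 n)) -> Q w.
  by move=> H /H; apply.
apply: span_ind => [|a _ h [y [u ->]] Qh] f0 f0E.
  have -> : f0 = 0 by apply: next_val_inj => d; rewrite f0E (lin0 (next_val_linl d)).
  exact: P0.
have -> : f0 = a *: tstep y u + (f0 - a *: tstep y u) by rewrite addrC subrK.
apply: PD; apply: Qh; apply/funext => d.
rewrite (linB (next_val_linl d)) (linZ (next_val_linl d)) f0E fct_linE next_inE.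
by rewrite addrC addKr.
Qed.
End Tower.

Lemma PoszS1 i : Posz i + 1 = Posz i.+1. Proof. by rewrite addrC. Qed.
Lemma NegzS1 i : Negz i.+1 + 1 = Negz i. Proof. by rewrite !NegzE -[i.+2]addn1 PoszD opprD addrNK. Qed.
Lemma PoszSB1 i : Posz i.+1 - 1 = Posz i. Proof. by rewrite -addn1 PoszD addrK. Qed.
Lemma NegzB1 i : Negz i - 1 = Negz i.+1. Proof. by rewrite -NegzS1 addrK. Qed.
Lemma Posz1n i : (1 : int) *+ i.+1 = Posz i.+1. Proof. by rewrite pmulrn intz. Qed.
Lemma Negz1n i : (-1 : int) *+ i.+1 = Negz i. Proof. by rewrite NegzE mulNrn Posz1n. Qed.

Section DirectSum.
Variables (K : fieldType) (X : int -> lmodType K).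

Record dsum := DSum {
  dcoord :> forall n, X n;
  dfin : exists s : seq int, forall n, n \notin s -> dcoord n = 0 }.

HB.instance Definition _ := gen_eqMixin dsum.
HB.instance Definition _ := gen_choiceMixin dsum.

Lemma dsum_eq (f h : dsum) : (forall n, f n = h n) -> f = h.
Proof.
case: f h => [f ff] [h hf] /= fh; have E : f = h by apply: functional_extensionality_dep.
by subst h; congr DSum; apply: Prop_irrelevance.
Qed.

Definition dzero : dsum := @DSum (fun=> 0) (ex_intro _ [::] (fun _ _ => erefl)).
Lemma dadd_subproof (f h : dsum) :
  exists s : seq int, forall n, n \notin s -> f n + h n = 0.
Proof.
have [[s sP] [t tP]] := (dfin f, dfin h); exists (s ++ t) => n.
by rewrite mem_cat negb_or => /andP[/sP-> /tP->]; rewrite addr0.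
Qed.
Definition dadd (f h : dsum) : dsum := DSum (dadd_subproof f h).
Lemma dopp_subproof (f : dsum) : exists s : seq int, forall n, n \notin s -> - f n = 0.
Proof. by have [s sP] := dfin f; exists s => n /sP->; rewrite oppr0. Qed.
Definition dopp (f : dsum) : dsum := DSum (dopp_subproof f).
Lemma dscale_subproof (a : K) (f : dsum) :
  exists s : seq int, forall n, n \notin s -> a *: f n = 0.
Proof. by have [s sP] := dfin f; exists s => n /sP->; rewrite scaler0. Qed.
Definition dscale a (f : dsum) : dsum := DSum (dscale_subproof a f).

Lemma daddA : associative dadd.
Proof. by move=> x y z; apply: dsum_eq => n /=; rewrite addrA. Qed.
Lemma daddC : commutative dadd.
Proof. by move=> x y; apply: dsum_eq => n /=; rewrite addrC. Qed.
Lemma dadd0 : left_id dzero dadd.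
Proof. by move=> x; apply: dsum_eq => n /=; rewrite add0r. Qed.
Lemma daddN : left_inverse dzero dopp dadd.
Proof. by move=> x; apply: dsum_eq => n /=; rewrite addNr. Qed.
HB.instance Definition _ := GRing.isZmodule.Build dsum daddA daddC dadd0 daddN.

Lemma dscaleA a b v : dscale a (dscale b v) = dscale (a * b) v.
Proof. by apply: dsum_eq => n /=; rewrite scalerA. Qed.
Lemma dscale1 : left_id 1 dscale.
Proof. by move=> x; apply: dsum_eq => n /=; rewrite scale1r. Qed.
Lemma dscaleDr : right_distributive dscale +%R.
Proof. by move=> a x y; apply: dsum_eq => n /=; rewrite scalerDr. Qed.
Lemma dscaleDl v : {morph dscale^~ v : a b / a + b}.
Proof. by move=> a b; apply: dsum_eq => n /=; rewrite scalerDl. Qed.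
HB.instance Definition _ :=
  GRing.Zmodule_isLmodule.Build K dsum dscaleA dscale1 dscaleDr dscaleDl.

Lemma dcoord_lin n : linear (fun f : dsum => f n).
Proof. by []. Qed.

Definition dinj_coord n (x : X n) (k : int) : X k :=
  if n =P k is ReflectT e then ecast k (X k) e x else 0.
Lemma dinj_subproof n (x : X n) :
  exists s : seq int, forall k, k \notin s -> dinj_coord x k = 0.
Proof.
exists [:: n] => k; rewrite inE /dinj_coord => kn; case: eqP => // e.
by case/eqP: kn; rewrite e.
Qed.
Definition dinj n (x : X n) : dsum := DSum (dinj_subproof x).

Lemma dinj_id n (x : X n) : dinj x n = x.
Proof. by rewrite /= /dinj_coord; case: eqP => // e; rewrite eq_axiomK. Qed.
Lemma dinj_ne n (x : X n) k : n != k -> dinj x k = 0.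
Proof. by rewrite /= /dinj_coord; case: eqP. Qed.
Lemma dinj_lin n : linear (@dinj n).
Proof.
move=> a x y; apply: dsum_eq => k; rewrite dcoord_lin.
have [e|ne] := eqVneq n k; first by subst k; rewrite !dinj_id.
by rewrite !dinj_ne // scaler0 addr0.
Qed.
Lemma dinj_inj n : injective (@dinj n).
Proof. by move=> x y /(congr1 (fun f : dsum => f n)); rewrite !dinj_id. Qed.

Lemma dsumE (f : dsum) (s : seq int) : uniq s ->
  (forall n, n \notin s -> f n = 0) -> f = \sum_(n <- s) dinj (f n).
Proof.
move=> us sP; apply: dsum_eq => k.
rewrite (lin_sum (@dcoord_lin k)).
have [ks|/[dup] ks /sP->] := boolP (k \in s).
  rewrite (bigD1_seq k) //= big1_seq ?addr0; first by rewrite -[LHS](dinj_id (f k)).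
  by move=> i /andP[ik _]; rewrite -[LHS]/(dinj (f i) k) dinj_ne.
rewrite big1_seq // => i /andP[_ is_]; rewrite -[LHS]/(dinj (f i) k) dinj_ne //.
by apply: contraNneq ks => <-.
Qed.

Lemma dsum_supp (f : dsum) :
  exists2 s : seq int, uniq s & forall n, n \notin s -> f n = 0.
Proof.
have [s sP] := dfin f; exists (undup s); first exact: undup_uniq.
by move=> n; rewrite mem_undup; apply: sP.
Qed.

Lemma dsum_ind (P : dsum -> Prop) : P 0 -> (forall f h, P f -> P h -> P (f + h)) ->
  (forall n (x : X n), P (dinj x)) -> forall f, P f.
Proof.
move=> P0 PD PI f; have [s us sP] := dsum_supp f.
by rewrite (dsumE us sP); elim/big_ind: _.
Qed.

Section Lift.
Variables (W : lmodType K) (phi : forall n, X n -> W).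
Hypothesis phi_lin : forall n, linear (@phi n).
Definition dlift (f : dsum) : W := \sum_(n <- s2val (cid2 (dsum_supp f))) phi (f n).

Lemma dliftE (f : dsum) s : uniq s ->
  (forall n, n \notin s -> f n = 0) -> dlift f = \sum_(n <- s) phi (f n).
Proof.
rewrite /dlift; case: cid2 => t ut tP /= us sP.
have aux r r' : uniq r -> uniq r' -> (forall n, n \notin r -> f n = 0) ->
    {subset r <= r'} -> \sum_(n <- r) phi (f n) = \sum_(n <- r') phi (f n).
  move=> ur ur' rP rr'.
  have -> : \sum_(n <- r') phi (f n) = \sum_(n <- r' | n \in r) phi (f n).
    rewrite [RHS]big_mkcond; apply: eq_bigr => n _; case: ifP => // /negbT/rP ->.
    by rewrite (lin0 (@phi_lin n)).
  rewrite -[RHS]big_filter; apply: perm_big; apply: uniq_perm => //.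
    by rewrite filter_uniq.
  by move=> n; rewrite mem_filter andb_idr // => /rr'.
rewrite (aux t (undup (s ++ t))) ?(aux s (undup (s ++ t))) ?undup_uniq //.
  by move=> n ns; rewrite mem_undup mem_cat ns.
by move=> n ns; rewrite mem_undup mem_cat ns orbT.
Qed.

Lemma dlift_lin : linear dlift.
Proof.
move=> a f h; have [[s us sP] [t ut tP]] := (dsum_supp f, dsum_supp h).
pose r := undup (s ++ t); have ur : uniq r := undup_uniq _.
have rs n : n \notin r -> n \notin s.
  by rewrite mem_undup mem_cat negb_or => /andP[].
have rt n : n \notin r -> n \notin t.
  by rewrite mem_undup mem_cat negb_or => /andP[].
rewrite !(@dliftE _ r) //; try by move=> n nr; rewrite ?sP ?tP ?rs ?rt.
  rewrite scaler_sumr -big_split; apply: eq_bigr => n _.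
  by rewrite dcoord_lin phi_lin.
by move=> n nr; rewrite dcoord_lin sP ?tP ?rs ?rt // scaler0 addr0.
Qed.

Lemma dlift_inj n (x : X n) : dlift (dinj x) = phi x.
Proof.
rewrite (@dliftE _ [:: n]) ?big_seq1 ?dinj_id // => k.
by rewrite inE eq_sym; apply: dinj_ne.
Qed.
End Lift.

Definition homog (n : int) (f : dsum) : Prop := exists x : X n, f = dinj x.
End DirectSum.

Lemma dlift_linl (K : fieldType) (X : int -> lmodType K) (V W : lmodType K)
    (phi : V -> forall n, X n -> W) :
  (forall n, bilin (fun v => phi v n)) ->
  bilin (fun v => dlift (phi v)).
Proof.
move=> hphi; split=> [f a v w|v]; last by apply: dlift_lin => n; apply: (hphi n).2.
have [s us sP] := dsum_supp f.
rewrite !(@dliftE _ _ _ _ (fun n => (hphi n).2 _) f s) // scaler_sumr -big_split.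
by apply: eq_bigr => n _; rewrite (bilinPl (hphi n)).
Qed.

Lemma dsum_lin_ext (K : fieldType) (X : int -> lmodType K) (W : lmodType K)
    (f h : dsum X -> W) : linear f -> linear h ->
  (forall n (x : X n), f (dinj x) = h (dinj x)) -> f =1 h.
Proof.
move=> fl hl fh; apply: dsum_ind => [|u v fu fv|//]; first by rewrite !lin0.
by rewrite !linD // fu fv.
Qed.

(* The local Lie algebra V_1 + V_0 + V_{-1}, with loc_pair x y = [x, y] and
   V_0 = g acting on V_1 and V_{-1}. Only this part of a standard pentad enters
   the construction of the V_n; ldual below exchanges V_1 and V_{-1}, replacing
   Phi by Psi, so that the q_{-i} are the p_i of the dual local part. *)
Record localPart (K : fieldType) (g : lieAlgebra K) := LocalPart {
  loc1 : lieModule g;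
  locm1 : lieModule g;
  loc_pair : loc1 -> locm1 -> g;
  loc_bilin : bilin loc_pair;
  loc_equiv : forall a x y,
    [< a, loc_pair x y >] = loc_pair (a ∙ x) y + loc_pair x (a ∙ y) }.

Section Local.
Variables (K : fieldType) (g : lieAlgebra K).

Section Dual.
Variable d : localPart g.
Definition ldual_pair (y : locm1 d) (x : loc1 d) : g := - loc_pair x y.
Lemma ldual_bilin : bilin ldual_pair.
Proof.
have b := loc_bilin d.
split=> [x|y] a u v; rewrite /ldual_pair ?(bilinPl b) ?(bilinPr b);
by rewrite opprD scalerN.
Qed.
Lemma ldual_equiv a y x :
  [< a, ldual_pair y x >] = ldual_pair (a ∙ y) x + ldual_pair y (a ∙ x).
Proof. rewrite /ldual_pair (bilinNr (@lie_bilin _ g)) loc_equiv; zmod. Qed.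
Definition ldual : localPart g := LocalPart ldual_bilin ldual_equiv.
End Dual.

Variable d : localPart g.

(* p_1(v (x) u)(eta) = v(eta) . u - u(eta) . v *)
Definition base_lr (v u : loc1 d) (eta : locm1 d) : loc1 d :=
  loc_pair v eta ∙ u - loc_pair u eta ∙ v.
Lemma base_bilin : bilin (base_lr : loc1 d -> loc1 d -> (locm1 d -> loc1 d)).
Proof.
have b := loc_bilin d; have m := @act_bilin _ _ (loc1 d).
split=> [x|y] a u v; apply/funext => eta; rewrite fct_linE /base_lr;
rewrite (bilinPl b) (bilinPl m) (bilinPr m) scalerBr; zmod.
Qed.
Lemma base_lin v u : linear (base_lr v u).
Proof.
have b := loc_bilin d; have m := @act_bilin _ _ (loc1 d).
by move=> a x y; rewrite /base_lr !(bilinPr b) !(bilinPl m) scalerBr; zmod.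
Qed.
Lemma base_equiv a y u x :
  a ∙ base_lr y u x - base_lr y u (a ∙ x) = base_lr (a ∙ y) u x + base_lr y (a ∙ u) x.
Proof.
have m := @act_bilin _ _ (loc1 d).
have E (v w : loc1 d) : a ∙ (loc_pair v x ∙ w) =
    loc_pair (a ∙ v) x ∙ w + loc_pair v (a ∙ x) ∙ w + loc_pair v x ∙ (a ∙ w).
  by have := act_rep a (loc_pair v x) w; rewrite loc_equiv (bilinDl m) => ->; rewrite subrK.
by rewrite /base_lr (bilinBr m) !E; zmod.
Qed.
Definition base_level : level (loc1 d) (locm1 d) :=
  @Level _ _ _ _ (loc1 d) base_lr base_bilin base_lin base_equiv.

(* ltower i is V_{i+1}, lstep is p_{i+1} and leval evaluates V_{i+2} at y;
   for ldual d these are V_{-i-1}, q_{-i-1} and the evaluation at x *)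
Definition ltower (i : nat) : lieModule g :=
  tower (loc_bilin d) (@loc_equiv _ _ d) base_level i.
Definition lstep i (x : loc1 d) (z : ltower i) : ltower i.+1 := tstep x z.
Definition leval i (z : ltower i.+1) (y : locm1 d) : ltower i := teval z y.

Lemma lstep_bilin i : bilin (@lstep i). Proof. exact: tstep_bilin. Qed.
Lemma leval_bilin i : bilin (@leval i). Proof. exact: teval_bilin. Qed.
Lemma leval_inj i (f h : ltower i.+1) : leval f =1 leval h -> f = h.
Proof. exact: teval_inj. Qed.
Lemma leval_act i a (f : ltower i.+1) y : leval (a ∙ f) y = a ∙ leval f y - leval f (a ∙ y).
Proof. exact: teval_act. Qed.
Lemma lstep_act i a x (u : ltower i) :
  a ∙ lstep x u = lstep (a ∙ x) u + lstep x (a ∙ u).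
Proof. exact: tstep_act. Qed.
Lemma leval0 x (u : ltower 0) y :
  leval (lstep x u) y = loc_pair x y ∙ u - loc_pair (u : loc1 d) y ∙ (x : ltower 0).
Proof. by []. Qed.
Lemma levalS i x (u : ltower i.+1) y :
  leval (lstep x u) y = loc_pair x y ∙ u + lstep x (leval u y).
Proof. by []. Qed.
Lemma ltower_ind i (P : ltower i.+1 -> Prop) :
  P 0 -> (forall a x u f, P f -> P (a *: lstep x u + f)) -> forall f, P f.
Proof. exact: tower_ind. Qed.
End Local.

Section Comm.
Variables (K : fieldType) (W : lmodType K).
Implicit Types A B C : W -> W.
Definition comm A B : W -> W := fun w => A (B w) - B (A w).

Lemma comm_lin A B : linear A -> linear B -> linear (comm A B).
Proof. by move=> lA lB a u v; rewrite /comm !lA !lB !lA scalerBr; zmod. Qed.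
Lemma comm_jacobi A B C : linear A -> linear B -> linear C ->
  comm A (comm B C) = comm (comm A B) C + comm B (comm A C).
Proof.
move=> lA lB lC; apply/funext => w; rewrite -[RHS]/(_ w + _ w) /comm.
rewrite !(linB lA) !(linB lB) !(linB lC); zmod.
Qed.
Lemma comm_anti A B : comm A B = - comm B A.
Proof. by apply/funext => w; rewrite -[RHS]/(- _ w) /comm opprB. Qed.
Lemma comm_bilinr A a B C : linear A -> comm A (a *: B + C) = a *: comm A B + comm A C.
Proof.
by move=> lA; apply/funext => w; rewrite [RHS]fct_linE /comm !fct_linE lA scalerBr; zmod.
Qed.
Lemma comm0r A : linear A -> comm A 0 = 0.
Proof. by move=> lA; apply/funext => w; rewrite /comm (lin0 lA) subrr. Qed.
End Comm.

Section Operators.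
Variables (K : fieldType) (g : lieAlgebra K) (W : lmodType K).

Record is_local_rep (d : localPart g) (h : g -> W -> W) (e : loc1 d -> W -> W)
    (f : locm1 d -> W -> W) : Prop := IsLocalRep {
  lr_h_bilin : bilin h;
  lr_e_bilin : bilin e;
  lr_f_bilin : bilin f;
  lr_he : forall a x, comm (h a) (e x) = e (a ∙ x);
  lr_hf : forall a y, comm (h a) (f y) = f (a ∙ y);
  lr_ef : forall x y, comm (e x) (f y) = h (loc_pair x y) }.

Lemma local_rep_dual d h e f : @is_local_rep d h e f -> @is_local_rep (ldual d) h f e.
Proof.
case=> hb eb fb he hf ef; split=> // y x; rewrite comm_anti ef.
by apply/funext => w; exact: esym (bilinNl hb _ _).
Qed.

Variables (d : localPart g) (h : g -> W -> W) (e : loc1 d -> W -> W).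
Variable (f : locm1 d -> W -> W).

(* The smallest bilinear relation between V_{i+1} and End(W) compatible with
   z |-> [e x, -]: the graph of the action of V_{i+1} once shown functional *)
Inductive opgraph : forall i, ltower d i -> (W -> W) -> Prop :=
| og_base (x : loc1 d) : @opgraph 0 x (e x)
| og_step i x (z : ltower d i) E : opgraph z E -> opgraph (lstep x z) (comm (e x) E)
| og_zero i : @opgraph i 0 0
| og_lin i a (z z' : ltower d i) E E' :
    opgraph z E -> opgraph z' E' -> opgraph (a *: z + z') (a *: E + E').

Hypothesis hyp : is_local_rep h e f.
Let hb := lr_h_bilin hyp.
Let eb := lr_e_bilin hyp.
Let fb := lr_f_bilin hyp.

Lemma og_linear i (z : ltower d i) E : opgraph z E -> linear E.
Proof.
elim=> {i z E} [x|i x z E _ lE|i|i a z z' E E' _ lE _ lE'].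
- exact: eb.2.
- exact: comm_lin (eb.2 _) lE.
- by move=> a u v; rewrite -[RHS]/(a *: 0 + 0) scaler0 addr0.
- move=> b u v; rewrite !fct_linE lE lE'; exact: lin_shuffle.
Qed.

Lemma og_total i (z : ltower d i) : exists E, opgraph z E.
Proof.
elim: i z => [|i IH] z; first by exists (e z); apply: og_base.
elim/ltower_ind: z => [|a x u z [E hE]]; first by exists 0; apply: og_zero.
by have [F hF] := IH u; eexists; apply: og_lin hE; apply: og_step hF.
Qed.

Lemma og_act i (z : ltower d i) E a : opgraph z E -> opgraph (a ∙ z) (comm (h a) E).
Proof.
have lh := hb.2 a; have ab i0 := @act_bilin _ _ (ltower d i0).
elim=> {i z E} [x|i x z E zE IH|i|i b z z' E E' _ IH _ IH'].
- by rewrite (lr_he hyp); apply: og_base.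
- rewrite lstep_act comm_jacobi ?(lr_he hyp) //; first last.
  + exact: og_linear zE.
  + exact: eb.2.
  rewrite -[lstep (a ∙ x) z]scale1r -[comm (e _) E]scale1r.
  by apply: og_lin; apply: og_step.
- by rewrite (bilin0r (ab i)) comm0r //; apply: og_zero.
- by rewrite (bilinPr (ab i)) comm_bilinr //; apply: og_lin.
Qed.

Lemma og_base_eq (x : ltower d 0) E : opgraph x E -> E = e x.
Proof.
have aux i (z : ltower d i) F : opgraph z F ->
    (if i is 0 as i return ltower d i -> Prop then fun z => F = e z else fun=> True) z.
  elim=> {i z F} [//|//|[|i]//|[|i] a z z' F F' // _ -> _ ->].
    by apply/funext => w; rewrite (bilin0l eb).
  by apply/funext => w; rewrite fct_linE (bilinPl eb).
exact: aux.
Qed.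

Lemma og_eq i (z z' : ltower d i) E E' : z = z' -> E = E' -> opgraph z E -> opgraph z' E'.
Proof. by move=> -> ->. Qed.

Lemma ogD i (z z' : ltower d i) E E' :
  opgraph z E -> opgraph z' E' -> opgraph (z + z') (E + E').
Proof. by move=> H H'; rewrite -[z]scale1r -[E]scale1r; apply: og_lin. Qed.
Lemma ogN i (z : ltower d i) E : opgraph z E -> opgraph (- z) (- E).
Proof.
move=> H; rewrite -scaleN1r -[- E]scaleN1r -[_ *: z]addr0 -[_ *: E]addr0.
by apply: og_lin => //; apply: og_zero.
Qed.

Lemma og_eval i (z : ltower d i.+1) E y :
  opgraph z E -> opgraph (- leval z y) (comm (f y) E).
Proof.
have lf := fb.2 y.
have aux j (u : ltower d j) F : opgraph u F ->
    (if j is j'.+1 as j return ltower d j -> Prop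
     then fun u => opgraph (- leval u y) (comm (f y) F) else fun=> True) u; last exact: aux.
elim=> {j u F} [//|j x u F uF IH|[|j]//|[|j] a u u' F F' // _ IH _ IH'].
- have lF := og_linear uF.
  rewrite comm_jacobi //; last exact: eb.2.
  have -> : comm (comm (f y) (e x)) F = - comm (h (loc_pair x y)) F.
    rewrite [comm (f y) _]comm_anti (lr_ef hyp); apply/funext => w.
    by rewrite -[RHS]/(- _ w) /comm -![(- h _) _]/(- (h _ _)) (linN lF) opprB opprK addrC.
  have A := ogN (og_act (loc_pair x y) uF).
  case: j u uF IH A => [|j] u uF IH A.
    rewrite (og_base_eq uF) [comm (f y) (e u)]comm_anti (lr_ef hyp) -(og_base_eq uF).
    have -> : comm (e x) (- h (loc_pair (u : loc1 d) y)) =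
        e (loc_pair (u : loc1 d) y ∙ x).
      rewrite -(lr_he hyp); apply/funext => w; rewrite /comm -![(- h _) _]/(- (h _ _)).
      by rewrite (linN (eb.2 x)) opprK addrC.
    rewrite leval0 opprB addrC; apply: ogD => //; exact: og_base.
  rewrite levalS opprD; apply: ogD => //.
  by rewrite -(bilinNr (@lstep_bilin _ _ d j)); apply: og_step.
- by rewrite (bilin0l (@leval_bilin _ _ d j)) oppr0 comm0r //; apply: og_zero.
rewrite comm_bilinr // (bilinPl (@leval_bilin _ _ d j)) opprD -scalerN.
exact: og_lin.
Qed.

Hypothesis og_fun0 : forall i E, @opgraph i.+1 0 E -> (forall y, comm (f y) E = 0) -> E = 0.

Lemma og_fun i (z : ltower d i) E E' : opgraph z E -> opgraph z E' -> E = E'.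
Proof.
suff H0 F : @opgraph i 0 F -> F = 0.
  move=> zE zE'; apply/eqP; rewrite -subr_eq0; apply/eqP; apply: H0.
  by rewrite -(subrr z); apply: ogD => //; apply: ogN.
elim: i {z} F => [|i IH] F zF.
  by rewrite (og_base_eq zF); apply/funext => w; rewrite (bilin0l eb).
apply: (og_fun0 zF) => y; apply: IH.
by have := og_eval y zF; rewrite (bilin0l (@leval_bilin _ _ d i)) oppr0.
Qed.

Definition opact i (z : ltower d i) : W -> W := sval (cid (og_total z)).

Lemma opactP i (z : ltower d i) : opgraph z (opact z).
Proof. by rewrite /opact; case: cid. Qed.
Lemma opactE i (z : ltower d i) E : opgraph z E -> opact z = E.
Proof. by apply: og_fun; apply: opactP. Qed.
Lemma opact0 (x : loc1 d) : @opact 0 x = e x.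
Proof. by apply: opactE; apply: og_base. Qed.
Lemma opact_step i x (z : ltower d i) : opact (lstep x z) = comm (e x) (opact z).
Proof. by apply: opactE; apply: og_step; apply: opactP. Qed.
Lemma opact_bilin i : bilin (@opact i).
Proof.
split=> [w a z z'|z]; last exact: og_linear (opactP z).
by rewrite (opactE (og_lin a (opactP z) (opactP z'))).
Qed.
Lemma opact_act i a (z : ltower d i) : opact (a ∙ z) = comm (h a) (opact z).
Proof. by apply: opactE; apply: og_act; apply: opactP. Qed.
Lemma opact_eval i y (z : ltower d i.+1) : opact (- leval z y) = comm (f y) (opact z).
Proof. by apply: opactE; apply: og_eval; apply: opactP. Qed.
End Operators.

Section Adjoint.
Variables (K : fieldType) (g : lieAlgebra K) (d : localPart g) (W : lmodType K).
Variables (h : g -> W -> W) (e : loc1 d -> W -> W) (f : locm1 d -> W -> W).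
Hypothesis hyp : is_local_rep h e f.
Variables (i0 : g -> W) (ip : forall i, ltower d i -> W) (im : locm1 d -> W).
Hypotheses
  (ip_lin : forall i, linear (@ip i))
  (ip_inj : forall i, injective (@ip i))
  (h_p : forall a i z, h a (@ip i z) = ip (a ∙ z))
  (e_0 : forall x a, e x (i0 a) = - @ip 0 (a ∙ x))
  (e_p : forall x i z, e x (@ip i z) = ip (lstep x z))
  (e_m : forall x y, e x (im y) = i0 (loc_pair x y))
  (f_p0 : forall y x, f y (@ip 0 x) = - i0 (loc_pair x y))
  (f_pS : forall y i z, f y (@ip i.+1 z) = - ip (leval z y))
  (full_ext : forall E : W -> W, linear E -> (forall a, E (i0 a) = 0) ->
     (forall i z, E (@ip i z) = 0) -> (forall y, E (im y) = 0) ->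
     (forall y w, E (f y w) = f y (E w)) -> E = 0).
Let hb := lr_h_bilin hyp.
Let eb := lr_e_bilin hyp.
Let fb := lr_f_bilin hyp.
Local Notation og := (opgraph e).

Lemma ip_range i (z : ltower d i) E : og z E -> forall j (w : ltower d j),
  exists2 k, k = (i + j).+1 & exists u : ltower d k, E (ip w) = ip u.
Proof.
elim=> {i z E} [x|i x z E _ IH|i|i a z z' E E' _ IH _ IH'] j w.
- by exists j.+1 => //; exists (lstep x w); rewrite e_p.
- have [k kE [u uE]] := IH j w; have [l lE [v vE]] := IH j.+1 (lstep x w).
  exists k.+1; first by rewrite kE.
  have kl : l = k.+1 by rewrite lE kE addnS.
  subst l; rewrite kl in v vE *.
  exists (lstep x u - v).
  by rewrite /comm uE e_p e_p vE (linB (@ip_lin _)).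
- by exists (i + j).+1 => //; exists 0; rewrite (lin0 (@ip_lin _)).
have [k kE [u uE]] := IH j w; have [l lE [v vE]] := IH' j w; subst k l.
exists (i + j).+1 => //; exists (a *: u + v).
by rewrite fct_linE uE vE ip_lin.
Qed.

Lemma ip_faithful k (u : ltower d k.+1) : (forall y, f y (ip u) = 0) -> u = 0.
Proof.
move=> H; apply: leval_inj => y; rewrite (bilin0l (@leval_bilin _ _ d k)).
apply: (@ip_inj k); rewrite (lin0 (@ip_lin k)).
by apply/eqP; rewrite -oppr_eq0 -f_pS H.
Qed.

Definition og_anti i (z : ltower d i) E :=
  [/\ forall a, E (i0 a) = - ip (a ∙ z),
      forall y, E (im y) = - f y (ip z) &
      forall x, E (@ip 0 x) = - e x (ip z)].

Lemma lstep_anti (x u : loc1 d) : @lstep _ _ d 0 x u = - lstep u (x : ltower d 0).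
Proof.
have b := @leval_bilin _ _ d 0.
by apply: leval_inj => y; rewrite (bilinNl b) !leval0 opprB.
Qed.

Lemma comm_app (A B : W -> W) w : A (B w) = comm A B w + B (A w).
Proof. by rewrite subrK. Qed.

Lemma og_antiP i (z : ltower d i) E : og z E -> og_anti z E.
Proof.
have [n] := ubnP i; elim: n i z E => // n IHn i z E ltin H.
elim: H ltin => {i z E} [x|i x z E zE IH|i|i a z z' E E' _ IH _ IH'] ltin.
- split=> [a|y|u]; first exact: e_0.
    by rewrite e_m f_p0 opprK.
  by rewrite !e_p lstep_anti (linN (@ip_lin _)).
- have [IHa IHy IHx] := IH (ltnW ltin).
  have lE := og_linear hyp zE.
  have lE' := og_linear hyp (og_step x zE).
  have Ha a : comm (e x) E (i0 a) = - ip (a ∙ lstep x z).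
    rewrite /comm IHa e_0 (linN (eb.2 x)) (linN lE) e_p IHx e_p lstep_act.
    by rewrite (linD (@ip_lin _)); zmod.
  split=> // [y|u].
    by rewrite /comm IHy e_m IHa (linN (eb.2 x)) -e_p (comm_app (e x) (f y)) (lr_ef hyp) h_p; zmod.
  have [k kE [v vE]] := ip_range (og_step x zE) (u : ltower d 0).
  rewrite addn0 in kE; subst k.
  apply/eqP; rewrite -addr_eq0 vE e_p -(linD (@ip_lin _)); apply/eqP.
  rewrite (_ : v + _ = 0) ?(lin0 (@ip_lin _)) //.
  apply: ip_faithful => y; rewrite (linD (@ip_lin _)) -vE -e_p (linD (fb.2 y)).
  rewrite (comm_app (f y) (comm (e x) E)) f_p0 (linN lE') Ha opprK.
  have [_ _ ->] := IHn _ _ _ ltin (og_eval hyp y (og_step x zE)).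
  rewrite (linN (@ip_lin _)) -f_pS (comm_app (f y) (e u)) comm_anti (lr_ef hyp).
  rewrite -[X in _ + (X + _)]/(- h _ _) h_p; zmod.
- have ab := @act_bilin _ _ (ltower d i).
  split=> [a|y|x]; rewrite ?(bilin0r (ab)) ?(lin0 (@ip_lin _)) ?(bilin0r fb) ?(bilin0r eb);
  by rewrite oppr0.
have ab := @act_bilin _ _ (ltower d i).
have [Ea Ey Ex] := IH ltin; have [Ea' Ey' Ex'] := IH' ltin.
split=> [b|y|x]; rewrite fct_linE ?Ea ?Ey ?Ex ?Ea' ?Ey' ?Ex'.
- by rewrite (bilinPr ab) ip_lin opprD scalerN.
- by rewrite ip_lin (bilinPr fb) opprD scalerN.
- by rewrite ip_lin (bilinPr eb) opprD scalerN.
Qed.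

Lemma og_adj_fun0 i E : @opgraph _ _ _ _ e i.+1 0 E -> (forall y, comm (f y) E = 0) -> E = 0.
Proof.
move=> H Hf; have lE := og_linear hyp H; have [Ea Ey Ex] := og_antiP H.
have ab := @act_bilin _ _ (ltower d i.+1).
have Ef y w : E (f y w) = f y (E w).
  apply/esym/eqP; rewrite -subr_eq0; apply/eqP.
  by rewrite -[LHS]/(comm (f y) E w) Hf.
apply: full_ext => // [a|j z|y].
- by rewrite Ea (bilin0r ab) (lin0 (@ip_lin _)) oppr0.
- elim: j z => [|j IH] z.
    by rewrite Ex (lin0 (@ip_lin _)) (bilin0r eb) oppr0.
  have [k kE [u uE]] := ip_range H z; subst k.
  rewrite uE (@ip_faithful _ u) ?(lin0 (@ip_lin _)) // => y.
  by rewrite -uE -Ef f_pS (linN lE) IH oppr0.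
- by rewrite Ey (lin0 (@ip_lin _)) (bilin0r fb) oppr0.
Qed.
End Adjoint.

Section GradedLie.
Variables (K : fieldType) (g : lieAlgebra K) (d : localPart g).

Definition Vcomp (n : int) : lieModule g :=
  match n with
  | Posz 0 => adjoint g
  | Posz i.+1 => ltower d i
  | Negz i => ltower (ldual d) i
  end.

Definition Lsum : lmodType K := dsum (fun n => Vcomp n : lmodType K).
Definition Linj (n : int) (z : Vcomp n) : Lsum :=
  dinj (X := fun n => Vcomp n : lmodType K) z.
Local Notation "'ι_ n z" := (@Linj n z) (at level 10, n at level 9, z at level 9).

(* The defining formulas of the bracket on L = (+)_n V_n; they determine it
   (assoc_bracket_unique). In degrees 1 and -1, y(x) = - Phi(x (x) y). *)
Record assoc_bracket_spec (br : Lsum -> Lsum -> Lsum) : Prop := AssocBracketSpec {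
  ab_bilin : bilin br;
  ab_0 : forall (a : g) n (z : Vcomp n), br ('ι_(Posz 0) a) ('ι_n z) = 'ι_n (a ∙ z);
  (* [x, z_n] *)
  ab_1_0 : forall (x : loc1 d) (a : g), br ('ι_(Posz 1) x) ('ι_(Posz 0) a) = - 'ι_(Posz 1) (a ∙ x);
  ab_1_pos : forall (x : loc1 d) i (z : Vcomp (Posz i.+1)),
    br ('ι_(Posz 1) x) ('ι_(Posz i.+1) z) = 'ι_(Posz i.+2) (lstep x z);
  ab_1_m1 : forall (x : loc1 d) (y : locm1 d),
    br ('ι_(Posz 1) x) ('ι_(Negz 0) y) = 'ι_(Posz 0) (loc_pair x y);
  ab_1_neg : forall (x : loc1 d) i (w : Vcomp (Negz i.+1)),
    br ('ι_(Posz 1) x) ('ι_(Negz i.+1) w) = - 'ι_(Negz i) (leval w x);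
  (* [y, z_n] *)
  ab_m1_0 : forall (y : locm1 d) (a : g), br ('ι_(Negz 0) y) ('ι_(Posz 0) a) = - 'ι_(Negz 0) (a ∙ y);
  ab_m1_neg : forall (y : locm1 d) i (w : Vcomp (Negz i)),
    br ('ι_(Negz 0) y) ('ι_(Negz i) w) = 'ι_(Negz i.+1) (lstep (y : loc1 (ldual d)) w);
  ab_m1_1 : forall (y : locm1 d) (x : loc1 d),
    br ('ι_(Negz 0) y) ('ι_(Posz 1) x) = - 'ι_(Posz 0) (loc_pair x y);
  ab_m1_pos : forall (y : locm1 d) i (z : Vcomp (Posz i.+2)),
    br ('ι_(Negz 0) y) ('ι_(Posz i.+2) z) = - 'ι_(Posz i.+1) (leval z y);
  (* [p_i (x (x) z_i), w] and [q_{-i} (y (x) w_{-i}), w], i >= 1 *)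
  ab_pos : forall (x : loc1 d) i (z : Vcomp (Posz i.+1)) u,
    br ('ι_(Posz i.+2) (lstep x z)) u =
      br ('ι_(Posz 1) x) (br ('ι_(Posz i.+1) z) u) - br ('ι_(Posz i.+1) z) (br ('ι_(Posz 1) x) u);
  ab_neg : forall (y : locm1 d) i (w : Vcomp (Negz i)) u,
    br ('ι_(Negz i.+1) (lstep (y : loc1 (ldual d)) w)) u =
      br ('ι_(Negz 0) y) (br ('ι_(Negz i) w) u) - br ('ι_(Negz i) w) (br ('ι_(Negz 0) y) u) }.

Lemma Linj_lin n : linear (@Linj n).
Proof. exact: dinj_lin. Qed.
Lemma Linj_inj n : injective (@Linj n).
Proof. exact: dinj_inj. Qed.
Lemma Lsum_ind (P : Lsum -> Prop) : P 0 -> (forall u v, P u -> P v -> P (u + v)) ->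
  (forall n z, P (@Linj n z)) -> forall u, P u.
Proof. exact: dsum_ind. Qed.
Lemma Lsum_ext (W : lmodType K) (f h : Lsum -> W) : linear f -> linear h ->
  (forall n z, f (@Linj n z) = h (@Linj n z)) -> f = h.
Proof. by move=> fl hl fh; apply/funext; apply: dsum_lin_ext. Qed.

Definition hL_comp (a : g) n (z : Vcomp n) : Lsum := 'ι_n (a ∙ z).
Definition hL (a : g) : Lsum -> Lsum := dlift (hL_comp a).
Definition eL_comp (x : loc1 d) n : Vcomp n -> Lsum :=
  match n return Vcomp n -> Lsum with
  | Posz 0 => fun a => - 'ι_(Posz 1) ((a : g) ∙ x : Vcomp (Posz 1))
  | Posz i.+1 => fun z => 'ι_(Posz i.+2) (lstep x z)
  | Negz 0 => fun y => 'ι_(Posz 0) (loc_pair x y : Vcomp (Posz 0))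
  | Negz i.+1 => fun w => - 'ι_(Negz i) (leval w x)
  end.
Definition eL (x : loc1 d) : Lsum -> Lsum := dlift (@eL_comp x).
Definition fL_comp (y : locm1 d) n : Vcomp n -> Lsum :=
  match n return Vcomp n -> Lsum with
  | Posz 0 => fun a => - 'ι_(Negz 0) ((a : g) ∙ y : Vcomp (Negz 0))
  | Posz 1 => fun x => - 'ι_(Posz 0) (loc_pair x y : Vcomp (Posz 0))
  | Posz i.+2 => fun z => - 'ι_(Posz i.+1) (leval z y)
  | Negz i => fun w => 'ι_(Negz i.+1) (@lstep _ _ (ldual d) i y w)
  end.
Definition fL (y : locm1 d) : Lsum -> Lsum := dlift (@fL_comp y).

Lemma hL_bilin_comp n : bilin (fun a => @hL_comp a n).
Proof.
have b := @act_bilin _ _ (Vcomp n).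
by split=> [z|a] k u v; rewrite /hL_comp ?(bilinPl b) ?(bilinPr b) Linj_lin.
Qed.
Lemma eL_bilin_comp n : bilin (fun x => @eL_comp x n).
Proof.
have lin_opp (k : K) (a b : Lsum) : - (k *: a + b) = k *: - a - b.
  by rewrite opprD scalerN.
case: n => [[|i]|[|i]]; (split=> [z|x] k u v; rewrite /eL_comp).
- by rewrite (bilinPr (@act_bilin _ _ (loc1 d))) (@Linj_lin (Posz 1)) lin_opp.
- by rewrite (bilinPl (@act_bilin _ _ (loc1 d))) (@Linj_lin (Posz 1)) lin_opp.
- by rewrite (bilinPl (@lstep_bilin _ _ d i)) (@Linj_lin (Posz i.+2)).
- by rewrite (bilinPr (@lstep_bilin _ _ d i)) (@Linj_lin (Posz i.+2)).
- by rewrite (bilinPl (loc_bilin d)) (@Linj_lin (Posz 0)).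
- by rewrite (bilinPr (loc_bilin d)) (@Linj_lin (Posz 0)).
- by rewrite (bilinPr (@leval_bilin _ _ (ldual d) i)) (@Linj_lin (Negz i)) lin_opp.
- by rewrite (bilinPl (@leval_bilin _ _ (ldual d) i)) (@Linj_lin (Negz i)) lin_opp.
Qed.
Lemma fL_bilin_comp n : bilin (fun y => @fL_comp y n).
Proof.
have lin_opp (k : K) (a b : Lsum) : - (k *: a + b) = k *: - a - b.
  by rewrite opprD scalerN.
case: n => [[|[|i]]|i]; (split=> [z|x] k u v; rewrite /fL_comp).
- by rewrite (bilinPr (@act_bilin _ _ (locm1 d))) (@Linj_lin (Negz 0)) lin_opp.
- by rewrite (bilinPl (@act_bilin _ _ (locm1 d))) (@Linj_lin (Negz 0)) lin_opp.
- by rewrite (bilinPr (loc_bilin d)) (@Linj_lin (Posz 0)) lin_opp.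
- by rewrite (bilinPl (loc_bilin d)) (@Linj_lin (Posz 0)) lin_opp.
- by rewrite (bilinPr (@leval_bilin _ _ d i)) (@Linj_lin (Posz i.+1)) lin_opp.
- by rewrite (bilinPl (@leval_bilin _ _ d i)) (@Linj_lin (Posz i.+1)) lin_opp.
- by rewrite (bilinPl (@lstep_bilin _ _ (ldual d) i)) (@Linj_lin (Negz i.+1)).
- by rewrite (bilinPr (@lstep_bilin _ _ (ldual d) i)) (@Linj_lin (Negz i.+1)).
Qed.
Lemma hL_bilin : bilin hL. Proof. exact: dlift_linl hL_bilin_comp. Qed.
Lemma eL_bilin : bilin eL. Proof. exact: dlift_linl eL_bilin_comp. Qed.
Lemma fL_bilin : bilin fL. Proof. exact: dlift_linl fL_bilin_comp. Qed.

Lemma hLE a n z : hL a ('ι_n z) = 'ι_n (a ∙ z).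
Proof. by rewrite /hL dlift_inj // => m; apply: (hL_bilin_comp m).2. Qed.
Lemma eLE x n z : eL x ('ι_n z) = eL_comp x z.
Proof. by rewrite /eL dlift_inj // => m; apply: (eL_bilin_comp m).2. Qed.
Lemma fLE y n z : fL y ('ι_n z) = fL_comp y z.
Proof. by rewrite /fL dlift_inj // => m; apply: (fL_bilin_comp m).2. Qed.

Lemma L_local_rep : is_local_rep hL eL fL.
Proof.
have [[hb eb] fb] := (hL_bilin, eL_bilin, fL_bilin).
have lN n (z : Vcomp n) : 'ι_n (- z) = - 'ι_n z by rewrite (linN (@Linj_lin n)).
have lD n (z z' : Vcomp n) : 'ι_n (z + z') = 'ι_n z + 'ι_n z' by rewrite (linD (@Linj_lin n)).
have lB n (z z' : Vcomp n) : 'ι_n (z - z') = 'ι_n z - 'ι_n z' by rewrite (linB (@Linj_lin n)).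
apply: (IsLocalRep hb eb fb) => [a x|a y|x y]; apply: Lsum_ext;
  try by [apply: comm_lin; first [exact: hb.2 | exact: eb.2 | exact: fb.2]
         | first [exact: hb.2 | exact: eb.2 | exact: fb.2]].
- case=> [[|i]|[|i]] z; rewrite /comm hLE !eLE /eL_comp.
  + rewrite (linN (hb.2 a)) hLE -[X in _ - - 'ι_(Posz 1) X]/([< a, (z : g) >] ∙ x) act_rep.
    by rewrite (lB (Posz 1)); zmod.
  + by rewrite hLE lstep_act (lD (Posz i.+2)); zmod.
  + by rewrite hLE -[a ∙ _]/([< a, loc_pair x z >]) loc_equiv (lD (Posz 0)); zmod.
  + by rewrite (linN (hb.2 a)) hLE leval_act (lB (Negz i)); zmod.
- case=> [[|[|i]]|i] z; rewrite /comm hLE !fLE /fL_comp.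
  + rewrite (linN (hb.2 a)) hLE -[X in _ - - 'ι_(Negz 0) X]/([< a, (z : g) >] ∙ y) act_rep.
    by rewrite (lB (Negz 0)); zmod.
  + rewrite (linN (hb.2 a)) hLE.
    rewrite -[X in - 'ι_(Posz 0) X - _]/([< a, loc_pair z y >]) loc_equiv.
    by rewrite (lD (Posz 0)); zmod.
  + by rewrite (linN (hb.2 a)) hLE leval_act (lB (Posz i.+1)); zmod.
  + by rewrite hLE lstep_act (lD (Negz i.+1)); zmod.
have bm1 := @act_bilin _ _ (loc1 d); have bmm := @act_bilin _ _ (locm1 d).
have bN i := @act_bilin _ _ (ltower (ldual d) i).
have pE (x' : loc1 d) (y' : locm1 d) : loc_pair (y' : loc1 (ldual d)) x' = - loc_pair x' y' by [].
case=> [[|[|i]]|[|i]] z; rewrite /comm hLE eLE fLE /eL_comp /fL_comp.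
- rewrite (linN (eb.2 x)) (linN (fb.2 y)) eLE fLE /eL_comp /fL_comp.
  rewrite -[X in _ = 'ι_(Posz 0) X]/([< loc_pair x y, (z : g) >]) lie_anti loc_equiv.
  by rewrite (lN (Posz 0)) (lD (Posz 0)); zmod.
- rewrite (linN (eb.2 x)) eLE fLE /eL_comp /fL_comp leval0 (lB (Posz 1)).
  by zmod.
- rewrite (linN (eb.2 x)) eLE fLE /eL_comp /fL_comp levalS (lD (Posz i.+2)).
  by zmod.
- rewrite eLE fLE /eL_comp /fL_comp leval0 !pE (bilinNl bmm) (bilinNl bmm) (lB (Negz 0)).
  by rewrite !(lN (Negz 0)); zmod.
rewrite (linN (fb.2 y)) eLE fLE /eL_comp /fL_comp levalS pE (bilinNl (bN i.+1)).
by rewrite (lD (Negz i.+1)) (lN (Negz i.+1)); zmod.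
Qed.

Local Notation Lpos := (fun i z => @Linj (Posz i.+1) z).
Local Notation Lneg := (fun i z => @Linj (Negz i) z).

Lemma L_pos_fun0 i E :
  @opgraph _ _ _ _ eL i.+1 0 E -> (forall y, comm (fL y) E = 0) -> E = 0.
Proof.
apply: (og_adj_fun0 L_local_rep (i0 := @Linj (Posz 0)) (ip := Lpos)
  (im := @Linj (Negz 0))) => {i E}.
- by move=> i; exact: (@Linj_lin (Posz i.+1)).
- by move=> i; exact: (@Linj_inj (Posz i.+1)).
- by move=> a i z; rewrite hLE.
- by move=> x a; rewrite eLE.
- by move=> x i z; rewrite eLE.
- by move=> x y; rewrite eLE.
- by move=> y x; rewrite fLE.
- by move=> y i z; rewrite fLE.
move=> E lE E0 Ep Em Ef; apply: Lsum_ext => //.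
  by move=> k u v; rewrite -[RHS]/(k *: 0 + 0) scaler0 addr0.
case=> [[|i]|i] z; [exact: E0 | exact: Ep |].
elim: i z => [|i IH] z; first exact: Em.
elim/ltower_ind: z => [|k y w z IHz]; first by rewrite (lin0 (@Linj_lin (Negz i.+1))) (lin0 lE).
rewrite (@Linj_lin (Negz i.+1)) lE IHz -[X in E X](fLE y (n := Negz i)) Ef IH.
by rewrite (lin0 (fL_bilin.2 y)) -[RHS]/(0 : Lsum) scaler0 addr0.
Qed.

Lemma L_neg_fun0 i E :
  @opgraph _ _ _ (ldual d) fL i.+1 0 E -> (forall x, comm (eL x) E = 0) -> E = 0.
Proof.
apply: (og_adj_fun0 (local_rep_dual L_local_rep) (i0 := @Linj (Posz 0)) (ip := Lneg)
  (im := @Linj (Posz 1))) => {i E}.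
- by move=> i; exact: (@Linj_lin (Negz i)).
- by move=> i; exact: (@Linj_inj (Negz i)).
- by move=> a i z; rewrite hLE.
- by move=> x a; rewrite fLE.
- by move=> x i z; rewrite fLE.
- by move=> y x; rewrite fLE /fL_comp -(linN (@Linj_lin (Posz 0))).
- by move=> x y; rewrite eLE -(linN (@Linj_lin (Posz 0))) /= /ldual_pair opprK.
- by move=> y i z; rewrite eLE.
move=> E lE E0 Ep Em Ef; apply: Lsum_ext => //.
  by move=> k u v; rewrite -[RHS]/(k *: 0 + 0) scaler0 addr0.
case=> [[|i]|i] z; [exact: E0 | | exact: Ep].
elim: i z => [|i IH] z; first exact: Em.
elim/ltower_ind: z => [|k y w z IHz]; first by rewrite (lin0 (@Linj_lin (Posz i.+2))) (lin0 lE).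
rewrite (@Linj_lin (Posz i.+2)) lE IHz -[X in E X](eLE y (n := Posz i.+1)) Ef IH.
by rewrite (lin0 (eL_bilin.2 y)) -[RHS]/(0 : Lsum) scaler0 addr0.
Qed.

Definition adL_comp n : Vcomp n -> (Lsum -> Lsum) :=
  match n return Vcomp n -> (Lsum -> Lsum) with
  | Posz 0 => hL
  | Posz i.+1 => fun z => opact eL z
  | Negz i => fun z => @opact _ _ _ (ldual d) fL i z
  end.
Definition adL : Lsum -> Lsum -> Lsum := dlift (W := (Lsum -> Lsum)) adL_comp.

Lemma adL_comp_bilin n : bilin (@adL_comp n).
Proof.
case: n => [[|i]|i]; first exact: hL_bilin.
  exact: (opact_bilin L_local_rep L_pos_fun0).
exact: (opact_bilin (local_rep_dual L_local_rep) L_neg_fun0).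
Qed.
Lemma adL_comp_lin n : linear (@adL_comp n : Vcomp n -> (Lsum -> Lsum)).
Proof. by move=> a u v; apply/funext => w; rewrite fct_linE (bilinPl (@adL_comp_bilin n)). Qed.

Lemma adLE n z : adL ('ι_n z) = adL_comp z.
Proof. by rewrite /adL (dlift_inj adL_comp_lin). Qed.

Lemma adL_bilin : bilin adL.
Proof.
split=> [w a u v|u]; first by rewrite /adL (dlift_lin adL_comp_lin).
elim/Lsum_ind: u => [|u v lu lv|n z]; last by rewrite adLE; apply: (@adL_comp_bilin n).2.
  by move=> k u v; rewrite /adL !(lin0 (dlift_lin adL_comp_lin)) -[RHS]/(k *: 0 + 0 : Lsum) scaler0 addr0.
move=> k w w'; rewrite /adL (linD (dlift_lin adL_comp_lin)) -[LHS]/(adL u _ + adL v _) lu lv.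
rewrite -[RHS]/(k *: (adL u w + adL v w) + (adL u w' + adL v w')).
by rewrite scalerDr addrACA.
Qed.

Lemma adL_1 (x : loc1 d) : adL ('ι_(Posz 1) x) = eL x.
Proof. by rewrite adLE /adL_comp (opact0 L_local_rep L_pos_fun0). Qed.
Lemma adL_m1 (y : locm1 d) : adL ('ι_(Negz 0) y) = fL y.
Proof. by rewrite adLE /adL_comp (opact0 (local_rep_dual L_local_rep) L_neg_fun0). Qed.

Lemma adL_spec : assoc_bracket_spec adL.
Proof.
split.
- exact: adL_bilin.
- by move=> a n z; rewrite (adLE (n := Posz 0)) /adL_comp hLE.
- by move=> x a; rewrite adL_1 eLE.
- by move=> x i z; rewrite adL_1 eLE.
- by move=> x y; rewrite adL_1 eLE.
- by move=> x i w; rewrite adL_1 eLE.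
- by move=> y a; rewrite adL_m1 fLE.
- by move=> y i w; rewrite adL_m1 fLE.
- by move=> y x; rewrite adL_m1 fLE.
- by move=> y i z; rewrite adL_m1 fLE.
- move=> x i z u; rewrite adL_1 (adLE (n := Posz i.+2)) (adLE (n := Posz i.+1)) /adL_comp.
  by rewrite (opact_step L_local_rep L_pos_fun0).
move=> y i w u; rewrite adL_m1 (adLE (n := Negz i.+1)) (adLE (n := Negz i)) /adL_comp.
by rewrite (opact_step (local_rep_dual L_local_rep) L_neg_fun0).
Qed.

Lemma assoc_bracket_unique br br' :
  assoc_bracket_spec br -> assoc_bracket_spec br' -> br = br'.
Proof.
move=> S S'; apply/funext => u.
have L br0 (S0 : assoc_bracket_spec br0) : linear (br0 : Lsum -> (Lsum -> Lsum)).
  by move=> a v w; apply/funext => t; rewrite fct_linE (bilinPl (ab_bilin S0)).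
suff: br = br' by move=> ->.
apply: Lsum_ext; [exact: L | exact: L |].
have lN n := (lin0 (@Linj_lin n)).
have b1 x : br ('ι_(Posz 1) x) = br' ('ι_(Posz 1) x).
  apply: Lsum_ext; [exact: (ab_bilin S).2 | exact: (ab_bilin S').2 |].
  case=> [[|i]|[|i]] z.
  - by rewrite (ab_1_0 S) (ab_1_0 S').
  - by rewrite (ab_1_pos S) (ab_1_pos S').
  - by rewrite (ab_1_m1 S) (ab_1_m1 S').
  - by rewrite (ab_1_neg S) (ab_1_neg S').
have bm1 y : br ('ι_(Negz 0) y) = br' ('ι_(Negz 0) y).
  apply: Lsum_ext; [exact: (ab_bilin S).2 | exact: (ab_bilin S').2 |].
  case=> [[|[|i]]|i] z.
  - by rewrite (ab_m1_0 S) (ab_m1_0 S').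
  - by rewrite (ab_m1_1 S) (ab_m1_1 S').
  - by rewrite (ab_m1_pos S) (ab_m1_pos S').
  - by rewrite (ab_m1_neg S) (ab_m1_neg S').
case=> [[|i]|i] z.
- apply: Lsum_ext; [exact: (ab_bilin S).2 | exact: (ab_bilin S').2 |] => n w.
  by rewrite (ab_0 S) (ab_0 S').
- elim: i z => [|i IH] z; first exact: b1.
  elim/ltower_ind: z => [|k x w z IHz]; first by rewrite (lN (Posz i.+2)) !lin0 //; exact: L.
  rewrite (@Linj_lin (Posz i.+2)) (L _ S) (L _ S') IHz; congr (_ *: _ + _).
  by apply/funext => t; rewrite (ab_pos S) (ab_pos S') !b1 !IH.
- elim: i z => [|i IH] z; first exact: bm1.
  elim/ltower_ind: z => [|k x w z IHz]; first by rewrite (lN (Negz i.+1)) !lin0 //; exact: L.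
  rewrite (@Linj_lin (Negz i.+1)) (L _ S) (L _ S') IHz; congr (_ *: _ + _).
  by apply/funext => t; rewrite (ab_neg S) (ab_neg S') !bm1 !IH.
Qed.

Lemma L_pos_anti i (z : ltower d i) E : opgraph eL z E ->
  [/\ forall a, E ('ι_(Posz 0) a) = - hL a ('ι_(Posz i.+1) z),
      forall y, E ('ι_(Negz 0) y) = - fL y ('ι_(Posz i.+1) z) &
      forall x, E ('ι_(Posz 1) x) = - eL x ('ι_(Posz i.+1) z)].
Proof.
move=> H; have := og_antiP L_local_rep (i0 := @Linj (Posz 0)) (ip := Lpos)
  (im := @Linj (Negz 0)) _ _ _ _ _ _ _ _ H.
case.
- by move=> j; exact: (@Linj_lin (Posz j.+1)).
- by move=> j; exact: (@Linj_inj (Posz j.+1)).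
- by move=> a j u; rewrite hLE.
- by move=> x a; rewrite eLE.
- by move=> x j u; rewrite eLE.
- by move=> x y; rewrite eLE.
- by move=> y x; rewrite fLE.
- by move=> y j u; rewrite fLE.
by move=> A B C; split=> // a; rewrite hLE A.
Qed.

Lemma L_neg_anti i (z : ltower (ldual d) i) E : @opgraph _ _ _ (ldual d) fL i z E ->
  [/\ forall a, E ('ι_(Posz 0) a) = - hL a ('ι_(Negz i) z),
      forall x, E ('ι_(Posz 1) x) = - eL x ('ι_(Negz i) z) &
      forall y, E ('ι_(Negz 0) y) = - fL y ('ι_(Negz i) z)].
Proof.
move=> H; have := og_antiP (local_rep_dual L_local_rep) (i0 := @Linj (Posz 0)) (ip := Lneg)
  (im := @Linj (Posz 1)) _ _ _ _ _ _ _ _ H.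
case.
- by move=> j; exact: (@Linj_lin (Negz j)).
- by move=> j; exact: (@Linj_inj (Negz j)).
- by move=> a j u; rewrite hLE.
- by move=> x a; rewrite fLE.
- by move=> x j u; rewrite fLE.
- by move=> y x; rewrite fLE /fL_comp -(linN (@Linj_lin (Posz 0))).
- by move=> x y; rewrite eLE -(linN (@Linj_lin (Posz 0))) /= /ldual_pair opprK.
- by move=> y j u; rewrite eLE.
by move=> A B C; split=> // a; rewrite hLE A.
Qed.

Lemma hL_comm a b : comm (hL a) (hL b) = hL [< a, b >].
Proof.
have hb := hL_bilin.
apply: Lsum_ext; [exact: comm_lin (hb.2 _) (hb.2 _) | exact: hb.2 |] => n z.
by rewrite /comm !hLE act_rep (linB (@Linj_lin n)).
Qed.

Let adl : linear (adL : Lsum -> (Lsum -> Lsum)).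
Proof. exact: dlift_lin adL_comp_lin. Qed.

Lemma adL_der (A : Lsum -> Lsum) : linear A ->
  (forall n (z : Vcomp n), comm A (adL ('ι_n z)) = adL (A ('ι_n z))) ->
  forall u, comm A (adL u) = adL (A u).
Proof.
move=> lA H; apply: Lsum_ind => // [|u v Hu Hv].
  by rewrite (lin0 adl) comm0r // (lin0 lA) (lin0 adl).
rewrite (linD lA) !(linD adl) -Hu -Hv; apply/funext => w.
by rewrite -[RHS]/(_ w + _ w) /comm -[(adL u + adL v) w]/(adL u w + adL v w)
  -[(adL u + adL v) (A w)]/(adL u (A w) + adL v (A w)) (linD lA); zmod.
Qed.

Lemma adL_0 a : adL ('ι_(Posz 0) a) = hL a.
Proof. exact: (adLE (n := Posz 0)). Qed.
Lemma adL_pos i z : adL ('ι_(Posz i.+1) z) = opact eL z.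
Proof. exact: (adLE (n := Posz i.+1)). Qed.
Lemma adL_neg i z : adL ('ι_(Negz i) z) = @opact _ _ _ (ldual d) fL i z.
Proof. exact: (adLE (n := Negz i)). Qed.
Lemma adLN u : adL (- u) = - adL u. Proof. exact: linN. Qed.

Lemma hL_der a u : comm (hL a) (adL u) = adL (hL a u).
Proof.
move: u; apply: adL_der; first exact: hL_bilin.2.
case=> [[|i]|i] z; rewrite hLE.
- by rewrite !adL_0 hL_comm.
- by rewrite !adL_pos -(opact_act L_local_rep L_pos_fun0).
- by rewrite !adL_neg -(opact_act (local_rep_dual L_local_rep) L_neg_fun0).
Qed.

Lemma eL_der x u : comm (eL x) (adL u) = adL (eL x u).
Proof.
move: u; apply: adL_der; first exact: eL_bilin.2.
case=> [[|i]|[|i]] z; rewrite eLE /eL_comp.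
- by rewrite adL_0 adLN adL_1 comm_anti (lr_he L_local_rep).
- by rewrite !adL_pos -(opact_step L_local_rep L_pos_fun0).
- by rewrite adL_m1 adL_0 (lr_ef L_local_rep).
- rewrite -(linN (@Linj_lin (Negz i))) !adL_neg.
  by rewrite -(opact_eval (local_rep_dual L_local_rep) L_neg_fun0).
Qed.

Lemma fL_der y u : comm (fL y) (adL u) = adL (fL y u).
Proof.
move: u; apply: adL_der; first exact: fL_bilin.2.
case=> [[|[|i]]|i] z; rewrite fLE /fL_comp.
- by rewrite adL_0 adLN adL_m1 comm_anti (lr_hf L_local_rep).
- by rewrite adLN adL_1 adL_0 comm_anti (lr_ef L_local_rep).
- rewrite -(linN (@Linj_lin (Posz i.+1))) !adL_pos.
  by rewrite -(opact_eval L_local_rep L_pos_fun0).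
- by rewrite !adL_neg -(opact_step (local_rep_dual L_local_rep) L_neg_fun0).
Qed.

Lemma L_gen_ind (P : Lsum -> Prop) : P 0 -> (forall k u v, P u -> P v -> P (k *: u + v)) ->
  (forall a, P ('ι_(Posz 0) a)) -> (forall x, P ('ι_(Posz 1) x)) ->
  (forall y, P ('ι_(Negz 0) y)) ->
  (forall x u, P u -> P (eL x u)) -> (forall y u, P u -> P (fL y u)) ->
  forall u, P u.
Proof.
move=> P0 PD Pa Px Py Pe Pf; apply: Lsum_ind => // [u v Pu Pv|].
  by rewrite -[u]scale1r; apply: PD.
case=> [[|i]|i] z; first exact: Pa.
- elim: i z => [|i IH] z; first exact: Px.
  elim/ltower_ind: z => [|k x w z IHz]; first by rewrite (lin0 (@Linj_lin (Posz i.+2))).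
  rewrite (@Linj_lin (Posz i.+2)); apply: PD => //.
  by have := Pe x _ (IH w); rewrite eLE.
- elim: i z => [|i IH] z; first exact: Py.
  elim/ltower_ind: z => [|k x w z IHz]; first by rewrite (lin0 (@Linj_lin (Negz i.+1))).
  rewrite (@Linj_lin (Negz i.+1)); apply: PD => //.
  by have := Pf x _ (IH w); rewrite fLE.
Qed.

Lemma comm_jacobi_app (A : Lsum -> Lsum) u v : linear A ->
  (forall w, comm A (adL w) = adL (A w)) ->
  (forall w, comm (adL u) (adL w) = adL (adL u w)) ->
  comm (adL (A u)) (adL v) = adL (adL (A u) v).
Proof.
move=> lA der IH; have lu := adL_bilin.2 u; have lv := adL_bilin.2 v.
have J := comm_jacobi lA lu lv; rewrite IH !der IH in J.
have -> : adL (A u) v = A (adL u v) - adL u (A v) by rewrite -der.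
by rewrite (linB adl) J addrK.
Qed.

Lemma adL_jacobi u v : comm (adL u) (adL v) = adL (adL u v).
Proof.
move: u v; apply: L_gen_ind => [v|k u u' Hu Hu' v|a v|x v|y v|x u Hu v|y u Hu v].
- rewrite (lin0 adl) -[X in _ = adL X]/(0 : Lsum) (lin0 adl) comm_anti comm0r ?oppr0 //.
  exact: adL_bilin.2.
- rewrite adl -[X in _ = adL X]/(k *: adL u v + adL u' v) adl -Hu -Hu'.
  rewrite comm_anti comm_bilinr; last exact: adL_bilin.2.
  by rewrite opprD -scalerN -!comm_anti.
- by rewrite adL_0 hL_der.
- by rewrite adL_1 eL_der.
- by rewrite adL_m1 fL_der.
- by apply: comm_jacobi_app => //; [exact: eL_bilin.2 | exact: eL_der].
- by apply: comm_jacobi_app => //; [exact: fL_bilin.2 | exact: fL_der].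
Qed.

Lemma adL_anti_0 a u : adL u ('ι_(Posz 0) a) = - hL a u.
Proof.
move: u; apply: Lsum_ind => [|u v Hu Hv|].
- by rewrite (lin0 adl) (lin0 (hL_bilin.2 a)) oppr0.
- by rewrite (linD adl) (linD (hL_bilin.2 a)) opprD -Hu -Hv.
case=> [[|i]|i] z.
- rewrite adL_0 !hLE -(linN (@Linj_lin (Posz 0))); congr (@Linj (Posz 0) _).
  exact: (@lie_anti K g).
- by have [] := L_pos_anti (opactP eL z); rewrite -adL_pos.
- by have [] := L_neg_anti (@opactP _ _ _ (ldual d) fL i z); rewrite -adL_neg.
Qed.
Lemma adL_anti_1 x u : adL u ('ι_(Posz 1) x) = - eL x u.
Proof.
move: u; apply: Lsum_ind => [|u v Hu Hv|].
- by rewrite (lin0 adl) (lin0 (eL_bilin.2 x)) oppr0.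
- by rewrite (linD adl) (linD (eL_bilin.2 x)) opprD -Hu -Hv.
case=> [[|i]|i] z.
- by rewrite adL_0 hLE eLE opprK.
- by have [] := L_pos_anti (opactP eL z); rewrite -adL_pos.
- by have [] := L_neg_anti (@opactP _ _ _ (ldual d) fL i z); rewrite -adL_neg.
Qed.
Lemma adL_anti_m1 y u : adL u ('ι_(Negz 0) y) = - fL y u.
Proof.
move: u; apply: Lsum_ind => [|u v Hu Hv|].
- by rewrite (lin0 adl) (lin0 (fL_bilin.2 y)) oppr0.
- by rewrite (linD adl) (linD (fL_bilin.2 y)) opprD -Hu -Hv.
case=> [[|i]|i] z.
- by rewrite adL_0 hLE fLE opprK.
- by have [] := L_pos_anti (opactP eL z); rewrite -adL_pos.
- by have [] := L_neg_anti (@opactP _ _ _ (ldual d) fL i z); rewrite -adL_neg.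
Qed.

Lemma adL_anti_step (A : Lsum -> Lsum) u v : linear A ->
  (forall w, comm A (adL w) = adL (A w)) ->
  (forall w, adL u w = - adL w u) -> adL (A u) v = - adL v (A u).
Proof.
move=> lA der IH; rewrite -der /comm IH (IH (A v)) (linN lA) -der /comm; zmod.
Qed.

Lemma adL_anti u v : adL u v = - adL v u.
Proof.
move: u v; apply: L_gen_ind => [v|k u u' Hu Hu' v|a v|x v|y v|x u Hu v|y u Hu v].
- by rewrite (lin0 adl) (lin0 (adL_bilin.2 v)) oppr0.
- by rewrite (bilinPl adL_bilin) (bilinPr adL_bilin) Hu Hu' opprD scalerN.
- by rewrite adL_0 adL_anti_0 opprK.
- by rewrite adL_1 adL_anti_1 opprK.
- by rewrite adL_m1 adL_anti_m1 opprK.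
- by apply: adL_anti_step => //; [exact: eL_bilin.2 | exact: eL_der].
- by apply: adL_anti_step => //; [exact: fL_bilin.2 | exact: fL_der].
Qed.

Lemma L_pos_self i (z : ltower d i) : adL ('ι_(Posz i.+1) z) ('ι_(Posz i.+1) z) = 0.
Proof.
have [] := ip_range (ip := Lpos) _ _ (opactP eL z) z => //.
- by move=> j; exact: (@Linj_lin (Posz j.+1)).
- by move=> x j u; rewrite eLE.
move=> k kE [u]; subst k; rewrite -adL_pos => E; rewrite E.
rewrite (_ : u = 0) ?(lin0 (@Linj_lin _)) //.
apply: (@ip_faithful _ _ _ _ fL Lpos) => [j|j|y j w|y].
- exact: (@Linj_lin (Posz j.+1)).
- exact: (@Linj_inj (Posz j.+1)).
- by rewrite fLE.
rewrite -E -[fL y _](subrK (adL ('ι_(Posz i.+1) z) (fL y ('ι_(Posz i.+1) z)))).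
rewrite -[X in X + _]/(comm (fL y) (adL ('ι_(Posz i.+1) z)) _) fL_der.
by rewrite adL_anti addNr.
Qed.

Lemma L_neg_self i (z : ltower (ldual d) i) : adL ('ι_(Negz i) z) ('ι_(Negz i) z) = 0.
Proof.
have [] := ip_range (ip := Lneg) _ _ (@opactP _ _ _ (ldual d) fL i z) z => //.
- by move=> j; exact: (@Linj_lin (Negz j)).
- by move=> x j u; rewrite fLE.
move=> k kE [u]; subst k; rewrite -adL_neg => E; rewrite E.
rewrite (_ : u = 0) ?(lin0 (@Linj_lin _)) //.
apply: (@ip_faithful _ _ (ldual d) _ eL Lneg) => [j|j|y j w|y].
- exact: (@Linj_lin (Negz j)).
- exact: (@Linj_inj (Negz j)).
- by rewrite eLE.
rewrite -E -[eL y _](subrK (adL ('ι_(Negz i) z) (eL y ('ι_(Negz i) z)))).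
rewrite -[X in X + _]/(comm (eL y) (adL ('ι_(Negz i) z)) _) eL_der.
by rewrite adL_anti addNr.
Qed.

Lemma adL_lie : is_lie_bracket adL.
Proof.
split; first exact: adL_bilin.
- apply: Lsum_ind => [|u v Hu Hv|]; first exact: bilin0r adL_bilin _.
    rewrite (bilinDl adL_bilin) !(bilinDr adL_bilin) Hu Hv (adL_anti u v); zmod.
  case=> [[|i]|i] z; [|exact: L_pos_self|exact: L_neg_self].
  by rewrite adL_0 hLE -[_ ∙ _]/([< (z : g), (z : g) >]) lie_alt (lin0 (@Linj_lin (Posz 0))).
move=> a b c; rewrite (adL_anti c (adL a b)) -adL_jacobi /comm (adL_anti c a).
by rewrite (linN (adL_bilin.2 b)); zmod.
Qed.

Lemma assoc_bracket_exists : exists br, assoc_bracket_spec br.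
Proof. by exists adL; apply: adL_spec. Qed.
Definition assoc_bracket : Lsum -> Lsum -> Lsum := sval (cid assoc_bracket_exists).
Lemma assoc_bracketP : assoc_bracket_spec assoc_bracket.
Proof. by rewrite /assoc_bracket; case: cid. Qed.
Lemma assoc_bracket_adL : assoc_bracket = adL.
Proof. exact: assoc_bracket_unique assoc_bracketP adL_spec. Qed.
Lemma assoc_bracket_lie : is_lie_bracket assoc_bracket.
Proof. by rewrite assoc_bracket_adL; apply: adL_lie. Qed.
End GradedLie.

Lemma homogD (K : fieldType) (X : int -> lmodType K) n (u v : dsum X) :
  homog n u -> homog n v -> homog n (u + v).
Proof. by move=> [x ->] [y ->]; exists (x + y); rewrite (linD (@dinj_lin _ X n)). Qed.
Lemma homogZ (K : fieldType) (X : int -> lmodType K) n a (u : dsum X) :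
  homog n u -> homog n (a *: u).
Proof. by move=> [x ->]; exists (a *: x); rewrite (linZ (@dinj_lin _ X n)). Qed.
Lemma homogN (K : fieldType) (X : int -> lmodType K) n (u : dsum X) :
  homog n u -> homog n (- u).
Proof. by rewrite -scaleN1r; apply: homogZ. Qed.
Lemma homog0 (K : fieldType) (X : int -> lmodType K) n : homog n (0 : dsum X).
Proof. by exists 0; rewrite (lin0 (@dinj_lin _ X n)). Qed.

Lemma og_homog (K : fieldType) (g : lieAlgebra K) (d : localPart g)
    (X : int -> lmodType K) (e : loc1 d -> dsum X -> dsum X) (s : int) :
  (forall x m w, homog m w -> homog (m + s) (e x w)) ->
  forall i (z : ltower d i) E, opgraph e z E ->
  forall m w, homog m w -> homog (m + s *+ i.+1) (E w).
Proof.
move=> He i z E; elim=> {i z E} [x|i x z E _ IH|i|i a z z' E E' _ IH _ IH'] m w hw.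
- exact: He.
- apply: homogD; first by rewrite mulrSr addrA; apply: He; apply: IH.
  by apply: homogN; rewrite mulrS addrA; apply: IH; apply: He.
- exact: homog0.
- by rewrite fct_linE; apply: homogD; [apply: homogZ; apply: IH | apply: IH'].
Qed.

Record gradedLieAlgebra (K : fieldType) := GradedLieAlgebra {
  gl_comp : int -> lmodType K;
  gl_br : dsum gl_comp -> dsum gl_comp -> dsum gl_comp;
  gl_lie : is_lie_bracket gl_br;
  gl_graded : forall n m u v, homog n u -> homog m v -> homog (n + m) (gl_br u v) }.

Record negatively_graded_module (K : fieldType) (L : gradedLieAlgebra K)
    (W : int -> lmodType K)
    (act : dsum (gl_comp L) -> dsum W -> dsum W) : Prop := NegativelyGradedModule {
  ngm_bilin : bilin act;
  ngm_rep : forall z z' w, act (gl_br z z') w = act z (act z' w) - act z' (act z w);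
  ngm_neg : forall m, (m > 0)%R -> forall w : W m, w = 0;
  ngm_graded : forall n m z w, homog n z -> homog m w -> homog (n + m) (act z w) }.

Section AssocLie.
Variables (K : fieldType) (g : lieAlgebra K) (d : localPart g).
Let X n : lmodType K := Vcomp d n.

Lemma assoc_bracket_graded n m (u v : Lsum d) :
  @homog _ X n u -> @homog _ X m v -> @homog _ X (n + m) (assoc_bracket u v).
Proof.
rewrite assoc_bracket_adL => -[x ->]; rewrite (adLE (x : Vcomp d n)).
have He y k (w : Lsum d) : @homog _ X k w -> @homog _ X (k + 1) (eL y w).
  move=> [t ->]; rewrite (eLE y (t : Vcomp d k)).
  case: k t => [[|i]|[|i]] t.
  - by apply: homogN; exists ((t : g) ∙ y).
  - by rewrite PoszS1; exists (lstep y t : Vcomp d (Posz i.+2)).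
  - by exists (loc_pair y t).
  - by rewrite NegzS1; apply: homogN; exists (leval t y).
have Hf y k (w : Lsum d) : @homog _ X k w -> @homog _ X (k - 1) (fL y w).
  move=> [t ->]; rewrite (fLE y (t : Vcomp d k)).
  case: k t => [[|[|i]]|i] t.
  - by apply: homogN; exists ((t : g) ∙ y).
  - by apply: homogN; exists (loc_pair t y : g).
  - by rewrite PoszSB1; apply: homogN; exists (leval t y).
  - by rewrite NegzB1; exists (lstep (y : loc1 (ldual d)) t : Vcomp d (Negz i.+1)).
case: n x => [[|i]|i] x hv.
- by have [y ->] := hv; rewrite add0r /adL_comp -[dinj y]/(Linj (y : Vcomp d m)) hLE; exists ((x : g) ∙ (y : Vcomp d m)).
- have := og_homog He (opactP (@eL _ _ d) (x : ltower d i)) hv.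
  by rewrite Posz1n addrC.
- have := @og_homog _ _ (ldual d) _ _ _ Hf i _ _ (opactP (d := ldual d) (@fL _ _ d) x) _ _ hv.
  by rewrite Negz1n addrC.
Qed.

Definition assoc_lie : gradedLieAlgebra K :=
  @GradedLieAlgebra K X (@assoc_bracket _ _ d) (assoc_bracket_lie d) assoc_bracket_graded.
End AssocLie.

Section NegativeExtension.
Variables (K : fieldType) (g : lieAlgebra K) (d : localPart g) (U : lieModule g).

(* the components of positive degree: 'rV_0 is the zero space *)
Lemma zero_rep : is_rep (fun (_ : g) (w : 'rV[K]_0) => w).
Proof.
split; first by split=> [v|a] k x y; rewrite ?[LHS]thinmx0 ?[RHS]thinmx0.
by move=> a b w; rewrite [LHS]thinmx0 [RHS]thinmx0.
Qed.
Definition zero_module : lieModule g := LieModule zero_rep.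

(* y, xi |-> [xi, y] *)
Definition ext_pair (y : locm1 d) (xi : loc1 d) : g := loc_pair xi y.
Lemma ext_pair_bilin : bilin ext_pair.
Proof. by have [A B] := loc_bilin d; split=> [xi|y]; [exact: B | exact: A]. Qed.
Lemma ext_pair_equiv a y xi :
  [< a, ext_pair y xi >] = ext_pair (a ∙ y) xi + ext_pair y (a ∙ xi).
Proof. by rewrite /ext_pair loc_equiv addrC. Qed.

(* r_0 (y (x) u)(xi) = [xi, y] . u *)
Definition ext_lr (y : locm1 d) (u : U) (xi : loc1 d) : U := ext_pair y xi ∙ u.
Lemma ext_lr_bilin : bilin (ext_lr : locm1 d -> U -> (loc1 d -> U)).
Proof.
have b := ext_pair_bilin; have m := @act_bilin _ _ U.
split=> [u|y] k v w; apply/funext => xi; rewrite fct_linE /ext_lr.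
  by rewrite (bilinPl b) (bilinPl m).
by rewrite (bilinPr m).
Qed.
Lemma ext_lr_lin y u : linear (ext_lr y u).
Proof.
by move=> k v w; rewrite /ext_lr (bilinPr ext_pair_bilin) (bilinPl (@act_bilin _ _ U)).
Qed.
Lemma ext_lr_equiv a y u xi :
  a ∙ ext_lr y u xi - ext_lr y u (a ∙ xi) = ext_lr (a ∙ y) u xi + ext_lr y (a ∙ u) xi.
Proof.
have := act_rep a (ext_pair y xi) u.
rewrite ext_pair_equiv (bilinDl (@act_bilin _ _ U)) => /eqP.
by rewrite eq_sym subr_eq /ext_lr => /eqP ->; zmod.
Qed.
Definition ext_level : level (locm1 d) (loc1 d) :=
  @Level _ _ _ _ U ext_lr ext_lr_bilin ext_lr_lin ext_lr_equiv.

(* utower j is U_{-j}, ustep is r_{-j} and ueval evaluates U_{-j-1} at xi *)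
Definition utower (j : nat) : lieModule g := tower ext_pair_bilin ext_pair_equiv ext_level j.
Definition ustep j (y : locm1 d) (u : utower j) : utower j.+1 := tstep y u.
Definition ueval j (u : utower j.+1) (xi : loc1 d) : utower j := teval u xi.

Lemma ustep_bilin j : bilin (@ustep j). Proof. exact: tstep_bilin. Qed.
Lemma ueval_bilin j : bilin (@ueval j). Proof. exact: teval_bilin. Qed.
Lemma ueval_inj j (u v : utower j.+1) : ueval u =1 ueval v -> u = v.
Proof. exact: teval_inj. Qed.
Lemma ueval_act j a (u : utower j.+1) x : ueval (a ∙ u) x = a ∙ ueval u x - ueval u (a ∙ x).
Proof. exact: teval_act. Qed.
Lemma ustep_act j a y (u : utower j) : a ∙ ustep y u = ustep (a ∙ y) u + ustep y (a ∙ u).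
Proof. exact: tstep_act. Qed.
Lemma ueval0 y (u : utower 0) x : ueval (ustep y u) x = loc_pair x y ∙ u.
Proof. by []. Qed.
Lemma uevalS j y (u : utower j.+1) x :
  ueval (ustep y u) x = loc_pair x y ∙ u + ustep y (ueval u x).
Proof. by []. Qed.
Lemma utower_ind j (P : utower j.+1 -> Prop) :
  P 0 -> (forall k y u v, P v -> P (k *: ustep y u + v)) -> forall v, P v.
Proof. exact: tower_ind. Qed.

Definition Ucomp (m : int) : lieModule g :=
  match m with
  | Posz 0 => U
  | Posz _.+1 => zero_module
  | Negz j => utower j.+1
  end.
Definition Usum : lmodType K := dsum (fun m => Ucomp m : lmodType K).
Definition Uinj (m : int) (u : Ucomp m) : Usum :=
  dinj (X := fun m => Ucomp m : lmodType K) u.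
(* the inclusion of U_{-j} *)
Definition Uneg (j : nat) : utower j -> Usum :=
  match j return utower j -> Usum with
  | 0 => @Uinj (Posz 0)
  | j.+1 => @Uinj (Negz j)
  end.

Local Notation "'ι_ n z" := (@Linj _ _ d n z) (at level 10, n at level 9, z at level 9).

(* The defining formulas of the action of L on (+)_m U_m; they determine it
   (negext_unique) *)
Record negext_spec (pi : Lsum d -> Usum -> Usum) : Prop := NegextSpec {
  ne_bilin : bilin pi;
  ne_0 : forall (a : g) m (u : Ucomp m), pi ('ι_(Posz 0) a) (Uinj u) = Uinj (a ∙ u);
  ne_1_nonneg : forall (x : loc1 d) (m : nat) (u : Ucomp (Posz m)),
    pi ('ι_(Posz 1) x) (Uinj u) = 0;
  ne_1_neg : forall (x : loc1 d) j (u : utower j.+1),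
    pi ('ι_(Posz 1) x) (Uneg u) = Uneg (ueval u x);
  ne_m1_pos : forall (y : locm1 d) (m : nat) (u : Ucomp (Posz m.+1)),
    pi ('ι_(Negz 0) y) (Uinj u) = 0;
  ne_m1_npos : forall (y : locm1 d) j (u : utower j),
    pi ('ι_(Negz 0) y) (Uneg u) = Uneg (ustep y u);
  ne_pos : forall (x : loc1 d) i (z : Vcomp d (Posz i.+1)) u,
    pi ('ι_(Posz i.+2) (lstep x z)) u =
      pi ('ι_(Posz 1) x) (pi ('ι_(Posz i.+1) z) u) - pi ('ι_(Posz i.+1) z) (pi ('ι_(Posz 1) x) u);
  ne_neg : forall (y : locm1 d) i (w : Vcomp d (Negz i)) u,
    pi ('ι_(Negz i.+1) (lstep (y : loc1 (ldual d)) w)) u =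
      pi ('ι_(Negz 0) y) (pi ('ι_(Negz i) w) u) - pi ('ι_(Negz i) w) (pi ('ι_(Negz 0) y) u) }.

Lemma Uinj_lin m : linear (@Uinj m).
Proof. exact: dinj_lin. Qed.
Lemma Uneg_lin j : linear (@Uneg j).
Proof. by case: j => [|j]; [exact: (@Uinj_lin (Posz 0)) | exact: (@Uinj_lin (Negz j))]. Qed.
Lemma Uneg_inj j : injective (@Uneg j).
Proof.
have inj := @dinj_inj K (fun m => Ucomp m : lmodType K).
by case: j => [|j]; [exact: (inj (Posz 0)) | exact: (inj (Negz j))].
Qed.
Lemma Uinj_pos m (u : Ucomp (Posz m.+1)) : Uinj u = 0.
Proof. by rewrite (thinmx0 (u : 'rV[K]_0)) (lin0 (@Uinj_lin (Posz m.+1))). Qed.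
Lemma Usum_ext (W : lmodType K) (f h : Usum -> W) : linear f -> linear h ->
  (forall j u, f (@Uneg j u) = h (@Uneg j u)) -> f = h.
Proof.
move=> fl hl fh; apply/funext; apply: dsum_lin_ext => // -[[|m]|j] u.
- exact: (fh 0).
- by rewrite -[dinj u]/(Uinj (u : Ucomp (Posz m.+1))) Uinj_pos (lin0 fl) (lin0 hl).
- exact: (fh j.+1).
Qed.

Definition hU_comp (a : g) m (u : Ucomp m) : Usum := Uinj (a ∙ u).
Definition hU (a : g) : Usum -> Usum := dlift (hU_comp a).
Definition eU_comp (x : loc1 d) m : Ucomp m -> Usum :=
  match m return Ucomp m -> Usum with
  | Posz _ => fun=> 0
  | Negz j => fun u => Uneg (ueval u x)
  end.
Definition eU (x : loc1 d) : Usum -> Usum := dlift (@eU_comp x).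
Definition fU_comp (y : locm1 d) m : Ucomp m -> Usum :=
  match m return Ucomp m -> Usum with
  | Posz 0 => fun u => @Uneg 1 (@ustep 0 y u)
  | Posz _.+1 => fun=> 0
  | Negz j => fun u => @Uneg j.+2 (@ustep j.+1 y u)
  end.
Definition fU (y : locm1 d) : Usum -> Usum := dlift (@fU_comp y).

Lemma hU_bilin_comp m : bilin (fun a => @hU_comp a m).
Proof.
have b := @act_bilin _ _ (Ucomp m).
by split=> [z|a] k u v; rewrite /hU_comp ?(bilinPl b) ?(bilinPr b) Uinj_lin.
Qed.
Lemma eU_bilin_comp m : bilin (fun x => @eU_comp x m).
Proof.
case: m => [m|j]; first by split=> [z|x] k u v; rewrite scaler0 addr0.
have b := @ueval_bilin j.
by split=> [z|a] k u v; rewrite /eU_comp ?(bilinPl b) ?(bilinPr b) Uneg_lin.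
Qed.
Lemma fU_bilin_comp m : bilin (fun y => @fU_comp y m).
Proof.
case: m => [[|m]|j].
- have b := @ustep_bilin 0.
  by split=> [z|a] k u v; rewrite /fU_comp ?(bilinPl b) ?(bilinPr b) (@Uneg_lin 1).
- by split=> [z|x] k u v; rewrite scaler0 addr0.
have b := @ustep_bilin j.+1.
by split=> [z|a] k u v; rewrite /fU_comp ?(bilinPl b) ?(bilinPr b) (@Uneg_lin j.+2).
Qed.
Lemma hU_bilin : bilin hU. Proof. exact: dlift_linl hU_bilin_comp. Qed.
Lemma eU_bilin : bilin eU. Proof. exact: dlift_linl eU_bilin_comp. Qed.
Lemma fU_bilin : bilin fU. Proof. exact: dlift_linl fU_bilin_comp. Qed.

Lemma hUi a m (u : Ucomp m) : hU a (Uinj u) = Uinj (a ∙ u).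
Proof. by rewrite /hU dlift_inj // => k; apply: (hU_bilin_comp k).2. Qed.
Lemma eUi x m (u : Ucomp m) : eU x (Uinj u) = eU_comp x u.
Proof. by rewrite /eU dlift_inj // => k; apply: (eU_bilin_comp k).2. Qed.
Lemma fUi y m (u : Ucomp m) : fU y (Uinj u) = fU_comp y u.
Proof. by rewrite /fU dlift_inj // => k; apply: (fU_bilin_comp k).2. Qed.
Lemma hUE a j (u : utower j) : hU a (Uneg u) = Uneg (a ∙ u).
Proof. by case: j u => [|j] u; [exact: (hUi _ (m := Posz 0)) | exact: (hUi _ (m := Negz j))]. Qed.
Lemma eU0 x (u : utower 0) : eU x (Uneg u) = 0.
Proof. exact: (eUi _ (m := Posz 0)). Qed.
Lemma eUS x j (u : utower j.+1) : eU x (Uneg u) = Uneg (ueval u x).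
Proof. exact: (eUi _ (m := Negz j)). Qed.
Lemma fUE y j (u : utower j) : fU y (Uneg u) = Uneg (ustep y u).
Proof. by case: j u => [|j] u; [exact: (fUi _ (m := Posz 0)) | exact: (fUi _ (m := Negz j))]. Qed.

Lemma U_local_rep : is_local_rep hU eU fU.
Proof.
have [[hb eb] fb] := (hU_bilin, eU_bilin, fU_bilin).
apply: (IsLocalRep hb eb fb) => [a x|a y|x y]; apply: Usum_ext;
  try by [apply: comm_lin; first [exact: hb.2 | exact: eb.2 | exact: fb.2]
         | first [exact: hb.2 | exact: eb.2 | exact: fb.2]].
- move=> [|j] u; rewrite /comm hUE.
    by rewrite !eU0 (lin0 (hb.2 a)) subrr.
  by rewrite !eUS hUE ueval_act (linB (@Uneg_lin j)); zmod.
- by move=> j u; rewrite /comm hUE !fUE hUE ustep_act (linD (@Uneg_lin j.+1)); zmod.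
move=> [|j] u; rewrite /comm hUE fUE eUS.
  by rewrite eU0 (lin0 (fb.2 y)) subr0.
by rewrite eUS fUE uevalS (linD (@Uneg_lin j.+1)); zmod.
Qed.

Lemma U_neg_range i (z : ltower (ldual d) i) E : @opgraph _ _ _ (ldual d) fU i z E ->
  forall j (w : utower j), exists2 k, k = (i + j).+1 & exists u : utower k, E (Uneg w) = Uneg u.
Proof.
elim=> {i z E} [x|i x z E _ IH|i|i a z z' E E' _ IH _ IH'] j w.
- by exists j.+1 => //; exists (ustep x w); rewrite fUE.
- have [k kE [u uE]] := IH j w; have [l lE [v vE]] := IH j.+1 (ustep x w).
  exists k.+1; first by rewrite kE.
  have kl : l = k.+1 by rewrite lE kE addnS.
  subst l; rewrite kl in v vE *.
  exists (ustep x u - v).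
  by rewrite /comm uE fUE fUE vE (linB (@Uneg_lin _)).
- by exists (i + j).+1 => //; exists 0; rewrite (lin0 (@Uneg_lin _)).
have [k kE [u uE]] := IH j w; have [l lE [v vE]] := IH' j w; subst k l.
exists (i + j).+1 => //; exists (a *: u + v).
by rewrite fct_linE uE vE Uneg_lin.
Qed.

Lemma U_pos_kill i (z : ltower d i) E : opgraph eU z E ->
  forall u : utower 0, E (Uneg u) = 0.
Proof.
elim=> {i z E} [x|i x z E zE IH|i|i a z z' E E' _ IH _ IH'] u.
- exact: eU0.
- by rewrite /comm IH eU0 (lin0 (eU_bilin.2 x)) (lin0 (og_linear U_local_rep zE)) subrr.
- by [].
- by rewrite fct_linE IH IH' scaler0 addr0.
Qed.

Lemma U_pos_fun0 i E :
  @opgraph _ _ _ _ eU i.+1 0 E -> (forall y, comm (fU y) E = 0) -> E = 0.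
Proof.
move=> H Hf; have lE := og_linear U_local_rep H.
apply: Usum_ext => //; first by move=> k u v; rewrite -[RHS]/(k *: 0 + 0) scaler0 addr0.
elim=> [|j IH] u; first exact: U_pos_kill H u.
elim/utower_ind: u => [|k y u v IHv]; first by rewrite (lin0 (@Uneg_lin j.+1)) (lin0 lE).
rewrite (@Uneg_lin j.+1) lE IHv -fUE.
have /(congr1 (fun f => f (Uneg u))) := Hf y; rewrite /comm IH (lin0 (fU_bilin.2 y)) sub0r.
by move=> /eqP; rewrite oppr_eq0 => /eqP ->; rewrite scaler0 addr0.
Qed.

Lemma U_neg_fun0 i E :
  @opgraph _ _ _ (ldual d) fU i.+1 0 E -> (forall x, comm (eU x) E = 0) -> E = 0.
Proof.
move=> H He; have lE := og_linear (local_rep_dual U_local_rep) H.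
apply: Usum_ext => //; first by move=> k u v; rewrite -[RHS]/(k *: 0 + 0) scaler0 addr0.
have comE x w : eU x (E w) = E (eU x w).
  by apply/eqP; rewrite -subr_eq0; apply/eqP; rewrite -[LHS]/(comm (eU x) E w) He.
have key j (u : utower j) : (forall x, eU x (E (Uneg u)) = 0) -> E (Uneg u) = 0.
  have [k kE [v ->]] := U_neg_range H u; subst k => Hv.
  rewrite (_ : v = 0) ?(lin0 (@Uneg_lin _)) //; apply: ueval_inj => x.
  rewrite (bilin0l (@ueval_bilin _)); apply: Uneg_inj.
  by rewrite -eUS Hv (lin0 (@Uneg_lin _)).
elim=> [|j IH] u; apply: key => x; rewrite comE.
  by rewrite eU0 (lin0 lE).
by rewrite eUS IH.
Qed.

Definition adU_comp n : Vcomp d n -> (Usum -> Usum) :=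
  match n return Vcomp d n -> (Usum -> Usum) with
  | Posz 0 => hU
  | Posz i.+1 => fun z => opact eU z
  | Negz i => fun z => @opact _ _ _ (ldual d) fU i z
  end.
Definition adU : Lsum d -> Usum -> Usum := dlift (W := (Usum -> Usum)) adU_comp.

Lemma adU_comp_bilin n : bilin (@adU_comp n).
Proof.
case: n => [[|i]|i]; first exact: hU_bilin.
  exact: (opact_bilin U_local_rep U_pos_fun0).
exact: (opact_bilin (local_rep_dual U_local_rep) U_neg_fun0).
Qed.
Lemma adU_comp_lin n : linear (@adU_comp n : Vcomp d n -> (Usum -> Usum)).
Proof. by move=> a u v; apply/funext => w; rewrite fct_linE (bilinPl (@adU_comp_bilin n)). Qed.
Lemma adUE n z : adU (@Linj _ _ d n z) = adU_comp z.
Proof. by rewrite /adU (dlift_inj adU_comp_lin). Qed.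
Let adl : linear (adU : Lsum d -> (Usum -> Usum)).
Proof. exact: dlift_lin adU_comp_lin. Qed.

Lemma adU_bilin : bilin adU.
Proof.
split=> [w a u v|u]; first by rewrite adl.
elim/Lsum_ind: u => [|u v lu lv|n z]; last by rewrite adUE; apply: (@adU_comp_bilin n).2.
  by move=> k u v; rewrite (lin0 adl) -[RHS]/(k *: 0 + 0 : Usum) scaler0 addr0.
move=> k w w'; rewrite (linD adl) -[LHS]/(adU u _ + adU v _) lu lv.
rewrite -[RHS]/(k *: (adU u w + adU v w) + (adU u w' + adU v w')).
by rewrite scalerDr addrACA.
Qed.
Lemma adU_1 (x : loc1 d) : adU ('ι_(Posz 1) x) = eU x.
Proof. by rewrite adUE /adU_comp (opact0 U_local_rep U_pos_fun0). Qed.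
Lemma adU_m1 (y : locm1 d) : adU ('ι_(Negz 0) y) = fU y.
Proof. by rewrite adUE /adU_comp (opact0 (local_rep_dual U_local_rep) U_neg_fun0). Qed.

Lemma adU_spec : negext_spec adU.
Proof.
split.
- exact: adU_bilin.
- by move=> a m u; rewrite (adUE (n := Posz 0)) /adU_comp hUi.
- by move=> x m u; rewrite adU_1 eUi.
- by move=> x j u; rewrite adU_1 eUS.
- by move=> y m u; rewrite Uinj_pos (lin0 (adU_bilin.2 _)).
- by move=> y j u; rewrite adU_m1 fUE.
- move=> x i z u; rewrite adU_1 (adUE (n := Posz i.+2)) (adUE (n := Posz i.+1)) /adU_comp.
  by rewrite (opact_step U_local_rep U_pos_fun0).
move=> y i w u; rewrite adU_m1 (adUE (n := Negz i.+1)) (adUE (n := Negz i)) /adU_comp.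
by rewrite (opact_step (local_rep_dual U_local_rep) U_neg_fun0).
Qed.

Lemma negext_exists : exists pi, negext_spec pi.
Proof. by exists adU; apply: adU_spec. Qed.
Definition negext_rep : Lsum d -> Usum -> Usum := sval (cid negext_exists).
Lemma negext_repP : negext_spec negext_rep.
Proof. by rewrite /negext_rep; case: cid. Qed.

Lemma negext_unique pi pi' : negext_spec pi -> negext_spec pi' -> pi = pi'.
Proof.
move=> S S'.
have L br0 (S0 : negext_spec br0) : linear (br0 : Lsum d -> (Usum -> Usum)).
  by move=> a v w; apply/funext => t; rewrite fct_linE (bilinPl (ne_bilin S0)).
apply: Lsum_ext; [exact: L | exact: L |].
have lN n := (lin0 (@Linj_lin _ _ d n)).
have b0 a : pi ('ι_(Posz 0) a) = pi' ('ι_(Posz 0) a).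
  apply: Usum_ext; [exact: (ne_bilin S).2 | exact: (ne_bilin S').2 |].
  by case=> [|j] u; rewrite /Uneg (ne_0 S) (ne_0 S').
have b1 x : pi ('ι_(Posz 1) x) = pi' ('ι_(Posz 1) x).
  apply: Usum_ext; [exact: (ne_bilin S).2 | exact: (ne_bilin S').2 |].
  case=> [|j] u; last by rewrite (ne_1_neg S) (ne_1_neg S').
  by rewrite /Uneg (@ne_1_nonneg _ S x 0 u) (@ne_1_nonneg _ S' x 0 u).
have bm1 y : pi ('ι_(Negz 0) y) = pi' ('ι_(Negz 0) y).
  apply: Usum_ext; [exact: (ne_bilin S).2 | exact: (ne_bilin S').2 |].
  by move=> j u; rewrite (ne_m1_npos S) (ne_m1_npos S').
case=> [[|i]|i] z; first exact: b0.
- elim: i z => [|i IH] z; first exact: b1.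
  elim/ltower_ind: z => [|k x w z IHz].
    by rewrite (lN (Posz i.+2)) (lin0 (L _ S)) (lin0 (L _ S')).
  rewrite (@Linj_lin _ _ d (Posz i.+2)) (L _ S) (L _ S') IHz; congr (_ *: _ + _).
  by apply/funext => t; rewrite (ne_pos S) (ne_pos S') !b1 !IH.
- elim: i z => [|i IH] z; first exact: bm1.
  elim/ltower_ind: z => [|k x w z IHz].
    by rewrite (lN (Negz i.+1)) (lin0 (L _ S)) (lin0 (L _ S')).
  rewrite (@Linj_lin _ _ d (Negz i.+1)) (L _ S) (L _ S') IHz; congr (_ *: _ + _).
  by apply/funext => t; rewrite (ne_neg S) (ne_neg S') !bm1 !IH.
Qed.
End NegativeExtension.

Section DualModule.
Variables (K : fieldType) (g : lieAlgebra K) (V : lieModule g).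
Variable S : subspace (V -> K^o).
Hypothesis S_lin : forall phi : V -> K^o, phi \in subspace_mem S -> linear phi.
Hypothesis S_stable : forall (a : g) (phi : V -> K^o), phi \in subspace_mem S ->
  (fun v => - phi (a ∙ v)) \in subspace_mem S.

Definition dual_act (a : g) (phi : sub_sort S) : sub_sort S :=
  SubSort (S_stable a (sub_valP phi)).

Lemma dual_rep : is_rep dual_act.
Proof.
have bV := @act_bilin _ _ V.
have vl (v : V) : linear (fun phi : sub_sort S => sub_val phi v).
  by move=> k phi psi; rewrite sub_val_lin.
have sl (phi : sub_sort S) := S_lin (sub_valP phi).
have E a phi v : sub_val (dual_act a phi) v = - sub_val phi (a ∙ v) by [].
split; [split|] => [phi k a b|a k phi psi|a b phi]; apply: sub_val_inj; apply/funext => v.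
- by rewrite vl !E (bilinPl bV) sl opprD scalerN.
- by rewrite vl !E vl opprD scalerN.
- by rewrite (linB (vl v)) !E act_rep (linB (sl phi)); zmod.
Qed.
Definition dual_module : lieModule g := LieModule dual_rep.
End DualModule.

Record standardPentad (K : fieldType) := StandardPentad {
  sp_g : lieAlgebra K;
  sp_V : lieModule sp_g;
  (* the submodule of Hom(V, K); the pairing <v, phi> is phi v *)
  sp_dual : subspace (sp_V -> K^o);
  sp_B : sp_g -> sp_g -> K^o;
  sp_g_neq0 : exists a : sp_g, a != 0;
  sp_B_bilin : bilin sp_B;
  sp_B_inv : forall a b c : sp_g, sp_B [< a, b >] c = sp_B a [< b, c >];
  sp_B_nondegl : forall a, (forall b, sp_B a b = 0) -> a = 0;
  sp_B_nondegr : forall b, (forall a, sp_B a b = 0) -> b = 0;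
  sp_dual_lin : forall phi : sp_V -> K^o, phi \in subspace_mem sp_dual -> linear phi;
  sp_dual_stable : forall (a : sp_g) (phi : sp_V -> K^o), phi \in subspace_mem sp_dual ->
    (fun v => - phi (a ∙ v)) \in subspace_mem sp_dual;
  sp_pair_nondegl : forall v : sp_V,
    (forall phi : sp_V -> K^o, phi \in subspace_mem sp_dual -> phi v = 0) -> v = 0;
  sp_pair_nondegr : forall phi : sp_V -> K^o, phi \in subspace_mem sp_dual ->
    (forall v, phi v = 0) -> phi = 0;
  sp_Phi : sp_V -> sub_sort sp_dual -> sp_g;
  sp_Phi_bilin : bilin sp_Phi;
  sp_PhiP : forall (a : sp_g) (v : sp_V) (phi : sub_sort sp_dual),
    sp_B a (sp_Phi v phi) = sub_val phi (a ∙ v) }.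

Section Pentad.
Variables (K : fieldType) (P : standardPentad K).

Definition pentad_dual : lieModule (sp_g P) :=
  dual_module (@sp_dual_lin K P) (@sp_dual_stable K P).

Lemma pentad_equiv (a : sp_g P) (v : sp_V P) (phi : pentad_dual) :
  [< a, sp_Phi v phi >] = sp_Phi (a ∙ v) phi + sp_Phi v (a ∙ phi : pentad_dual).
Proof.
have bB := sp_B_bilin P; have sl := sp_dual_lin (sub_valP phi).
apply/eqP; rewrite -subr_eq0; apply/eqP; apply: sp_B_nondegr => b.
rewrite (bilinBr bB) (bilinDr bB) -sp_B_inv !sp_PhiP.
rewrite -[sub_val (a ∙ phi) _]/(- sub_val phi (a ∙ (b ∙ v))) act_rep (linB sl).
by rewrite subrr.
Qed.

(* V_1 = V, V_{-1} = the submodule of Hom(V, K), x(y) = Phi (x (x) y) *)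
Definition pentad_local : localPart (sp_g P) :=
  @LocalPart K (sp_g P) (sp_V P) pentad_dual (@sp_Phi K P) (sp_Phi_bilin P) pentad_equiv.

Definition pentad_lie : gradedLieAlgebra K := assoc_lie pentad_local.

Variable U : lieModule (sp_g P).

Definition negative_extension (m : int) : lmodType K := Ucomp pentad_local U m.
Definition negative_extension_rep :
    dsum (gl_comp pentad_lie) -> dsum negative_extension -> dsum negative_extension :=
  @negext_rep K (sp_g P) pentad_local U.
End Pentad.

(* Main.v *)
(** The generators V_0, V_1, V_{-1} act on the negative extension by a
    representation of the local part, and L is spanned by iterated brackets of
    generators.  For a generator A the identity
    pi [A, z] = [pi A, pi z] is checked for z homogeneous: for deg A and deg z of
    the same sign it is the inductive definition of pi, for opposite signs it is
    the compatibility of the graph of pi with the evaluation maps.  Since ad A is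
    a derivation, the set of u with pi [u, v] = [pi u, pi v] for all v is stable
    under ad A, hence is all of L. *)
Require Import Defs.
From mathcomp Require Import all_boot all_algebra.
From mathcomp Require Import boolp functions.

Set Implicit Arguments.
Unset Strict Implicit.
Unset Printing Implicit Defensive.

Import GRing.Theory.
Local Open Scope ring_scope.

Section NegativeExtensionModule.
Variables (K : fieldType) (g : lieAlgebra K) (d : localPart g) (U : lieModule g).
Local Notation pi := (@adU K g d U).
Local Notation hu := (@hU K g d U).
Local Notation eu := (@eU K g d U).
Local Notation fu := (@fU K g d U).
Local Notation "'ι_ n z" := (@Linj _ _ d n z) (at level 10, n at level 9, z at level 9).

Let urep : is_local_rep hu eu fu := U_local_rep d U.
Let udual : @is_local_rep _ _ _ (ldual d) hu fu eu := local_rep_dual urep.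
(** [pos0] and [neg0] make the graph behind [opact] functional; the rules for [opact] used below
    take one of them as argument. *)
Let pos0 := @U_pos_fun0 K g d U.
Let neg0 := @U_neg_fun0 K g d U.

Lemma adU_lin : linear (pi : Lsum d -> (Usum d U -> Usum d U)).
Proof. by move=> a u v; apply/funext => w; rewrite (bilinPl (adU_bilin d U)). Qed.
Let pil := adU_lin.

Lemma adU_0 a : pi ('ι_(Posz 0) a) = hu a.
Proof. exact: (@adUE _ _ d U (Posz 0)). Qed.
Lemma adU_pos i z : pi ('ι_(Posz i.+1) z) = opact eu z.
Proof. exact: (@adUE _ _ d U (Posz i.+1)). Qed.
Lemma adU_neg i z : pi ('ι_(Negz i) z) = @opact _ _ _ (ldual d) fu i z.
Proof. exact: (@adUE _ _ d U (Negz i)). Qed.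

Lemma hU_comm a b : comm (hu a) (hu b) = hu [< a, b >].
Proof.
have hb := hU_bilin d U.
apply: Usum_ext; [exact: comm_lin (hb.2 _) (hb.2 _) | exact: hb.2 |] => j u.
by rewrite /comm !hUE act_rep (linB (@Uneg_lin _ _ d U j)).
Qed.

(** Both sides are linear in [u], a finite sum of homogeneous elements. In use, [A] and [B] are the
    operators of one generator on the module and on the algebra. *)
Lemma adU_der (A : Usum d U -> Usum d U) (B : Lsum d -> Lsum d) : linear A -> linear B ->
  (forall n (z : Vcomp d n), comm A (pi ('ι_n z)) = pi (B ('ι_n z))) ->
  forall u, comm A (pi u) = pi (B u).
Proof.
move=> lA lB H; apply: Lsum_ind => // [|u v Hu Hv].
  by rewrite (lin0 pil) comm0r // (lin0 lB) (lin0 pil).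
rewrite (linD lB) !(linD pil) -Hu -Hv.
by have := comm_bilinr 1 (pi u) (pi v) lA; rewrite !scale1r.
Qed.

Lemma hU_der a u : comm (hu a) (pi u) = pi (hL a u).
Proof.
move: u; apply: adU_der; [exact: (hU_bilin d U).2 | exact: (hL_bilin d).2 |].
case=> [[|i]|i] z; rewrite hLE.
- by rewrite !adU_0 hU_comm.
- by rewrite !adU_pos -(opact_act urep pos0).
- by rewrite !adU_neg -(opact_act udual neg0).
Qed.

Lemma eU_der x u : comm (eu x) (pi u) = pi (eL x u).
Proof.
move: u; apply: adU_der; [exact: (eU_bilin d U).2 | exact: (eL_bilin d).2 |].
case=> [[|i]|[|i]] z; rewrite eLE /eL_comp.
- by rewrite adU_0 (linN pil) adU_1 comm_anti (lr_he urep).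
- by rewrite !adU_pos -(opact_step urep pos0).
- by rewrite adU_m1 adU_0 (lr_ef urep).
(* Here $[x,z]=-z(x)$; in the dual local part [eu] is the lowering family, so its evaluation rule
   applies. *)
- rewrite -(linN (@Linj_lin _ _ d (Negz i))) !adU_neg.
  by rewrite -(opact_eval udual neg0).
Qed.

Lemma fU_der y u : comm (fu y) (pi u) = pi (fL y u).
Proof.
move: u; apply: adU_der; [exact: (fU_bilin d U).2 | exact: (fL_bilin d).2 |].
case=> [[|[|i]]|i] z; rewrite fLE /fL_comp.
- by rewrite adU_0 (linN pil) adU_m1 comm_anti (lr_hf urep).
- by rewrite (linN pil) adU_1 adU_0 comm_anti (lr_ef urep).
- rewrite -(linN (@Linj_lin _ _ d (Posz i.+1))) !adU_pos.
  by rewrite -(opact_eval urep pos0).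
- by rewrite !adU_neg -(opact_step udual neg0).
Qed.

(** Jacobi for the operators [A], [pi u], [pi v], compared with the derivation rule for [B]; the
    hypothesis on [u] enters at [v] and at [B v]. *)
Lemma adU_bracket_step (A : Usum d U -> Usum d U) (B : Lsum d -> Lsum d) u v :
  linear A ->
  (forall w, comm A (pi w) = pi (B w)) -> (forall w, comm B (adL w) = adL (B w)) ->
  (forall w, comm (pi u) (pi w) = pi (adL u w)) ->
  comm (pi (B u)) (pi v) = pi (adL (B u) v).
Proof.
move=> lA derA derB IH.
have J := comm_jacobi lA ((adU_bilin d U).2 u) ((adU_bilin d U).2 v).
rewrite IH !derA IH in J.
have -> : adL (B u) v = B (adL u v) - adL u (B v) by rewrite -derB.
by rewrite (linB pil) J addrK.
Qed.

Lemma adU_bracket u v : comm (pi u) (pi v) = pi (adL u v).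
Proof.
move: u v; apply: L_gen_ind => [v|k u u' Hu Hu' v|a v|x v|y v|x u Hu v|y u Hu v].
- rewrite (bilin0l (adL_bilin d)) (lin0 pil) comm_anti comm0r ?oppr0 //.
  exact: (adU_bilin d U).2.
- rewrite (bilinPl (adL_bilin d)) !pil -Hu -Hu'.
  rewrite comm_anti comm_bilinr; last exact: (adU_bilin d U).2.
  by rewrite opprD -scalerN -!comm_anti.
- by rewrite adU_0 adL_0 hU_der.
- by rewrite adU_1 adL_1 eU_der.
- by rewrite adU_m1 adL_m1 fU_der.
- by apply: (adU_bracket_step v _ (eU_der x)) => //;
    [exact: (eU_bilin d U).2 | exact: eL_der].
- by apply: (adU_bracket_step v _ (fU_der y)) => //;
    [exact: (fU_bilin d U).2 | exact: fL_der].
Qed.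

Let Y m : lmodType K := Ucomp d U m.

Lemma eU_homog x m (w : Usum d U) : @homog _ Y m w -> @homog _ Y (m + 1) (eu x w).
Proof.
move=> [t ->]; rewrite (eUi x (t : Ucomp d U m)).
(* Degree $-1$ is separate: evaluation there lands in $U_0$, across the constructors of [int]. *)
case: m t => [m|[|j]] t; first exact: homog0.
  by exists (@ueval _ _ d U 0 t x : Ucomp d U 0).
by rewrite NegzS1; exists (@ueval _ _ d U j.+1 t x : Ucomp d U (Negz j)).
Qed.

Lemma fU_homog y m (w : Usum d U) : @homog _ Y m w -> @homog _ Y (m - 1) (fu y w).
Proof.
move=> [t ->]; rewrite (fUi y (t : Ucomp d U m)).
case: m t => [[|m]|j] t; [|exact: homog0|].
  by exists (@ustep _ _ d U 0 y t : Ucomp d U (Negz 0)).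
by rewrite NegzB1; exists (@ustep _ _ d U j.+1 y t : Ucomp d U (Negz j.+1)).
Qed.

(** Degree $\pm(i+1)$ acts by linear combinations of nested commutators of $i+1$ generators, each
    shifting by $\pm1$. *)
Lemma adU_graded n m (u : Lsum d) (w : Usum d U) :
  @homog _ (fun n => Vcomp d n : lmodType K) n u -> @homog _ Y m w ->
  @homog _ Y (n + m) (pi u w).
Proof.
move=> -[x ->]; rewrite (@adUE _ _ d U n x).
case: n x => [[|i]|i] x hw.
- have [y ->] := hw; rewrite add0r /adU_comp -[dinj y]/(Uinj (y : Ucomp d U m)) hUi.
  by exists ((x : g) ∙ (y : Ucomp d U m)).
- have := og_homog eU_homog (opactP eu (x : ltower d i)) hw.
  by rewrite Posz1n addrC.
- have := @og_homog _ _ (ldual d) _ _ _ fU_homog i _ _ (opactP (d := ldual d) fu x) _ _ hw.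
  by rewrite Negz1n addrC.
Qed.
End NegativeExtensionModule.

Theorem theorem3p14 (K : fieldType) (P : standardPentad K) (U : lieModule (sp_g P)) :
  negatively_graded_module (L := pentad_lie P) (W := negative_extension U)
    (@negative_extension_rep K P U).
Proof.
(* The representation is chosen by its defining formulas; uniqueness makes it the explicit one. *)
have -> : @negative_extension_rep K P U = @adU _ _ (pentad_local P) U.
  exact: negext_unique (negext_repP _ _) (adU_spec _ _).
split.
- exact: adU_bilin.
- move=> z z' w.
  rewrite -[gl_br z z']/(assoc_bracket (d := pentad_local P) z z') assoc_bracket_adL.
  by rewrite -adU_bracket.
(* Positive components are row vectors of length 0. *)
- by case=> [[|m]|j] // _ w; exact: (thinmx0 (w : 'rV[K]_0)).
- move=> n m z w; exact: adU_graded.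
Qed.
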